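(* Let $p(\cdot)\in\mathcal P(\mathbb R^n)$ satisfy $p(\cdot)\in LH_0(\mathbb R^n)\cap LH_\infty(\mathbb R^n)$ and $1<p^-\le p^+<\infty$. If $w$ is a weight on $\mathbb R^n$, then the following are equivalent: (i) $N$ is of strong-type $(p(\cdot),p(\cdot))$ with respect to $w$; (ii) $S$ is of strong-type $(p(\cdot),p(\cdot))$ with respect to $w$; (iii) $w\in A_{p(\cdot),0}$.
   Context: $\mathcal P(\mathbb R^n)$ is the set of bounded measurable functions $p(\cdot):\mathbb R^n\to[1,\infty)$; $p^-=\inf_{x\in\mathbb R^n}p(x)$ and $p^+=\sup_{x\in\mathbb R^n}p(x)$. The conjugate exponent is defined pointwise by $1/p(x)+1/p'(x)=1$. For $r(\cdot)\in\mathcal P(\mathbb R^n)$ and measurable $f$, $\|f\|_{r(\cdot)}=\inf\{\mu>0:\int_{\mathbb R^n}(|f(x)|/\mu)^{r(x)}\,dx\le1\}\in[0,\infty]$. $p(\cdot)\in LH_0(\mathbb R^n)$ means there are $C_0>0$, $p_0\ge1$ with $|p(x)-p_0|\le \frac{C_0}{-\log|x|}$ for all $0<|x|<1/2$. $p(\cdot)\in LH_\infty(\mathbb R^n)$ means there are $C_\infty>0$, $p_\infty\ge1$ with $|p(x)-p_\infty|\le\frac{C_\infty}{\log(e+|x|)}$ for all $x\in\mathbb R^n$. A weight is a non-negative, locally integrable function $w$ on $\mathbb R^n$ with $0<w(x)<\infty$ a.e. $L^{p(\cdot)}_w(\mathbb R^n)$ is the set of measurable $f$ with $\|fw\|_{p(\cdot)}<\infty$.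 For measurable $f$ on $\mathbb R^n$ (with $f\ge0$ in the definition of $S$), $$Nf(x)=\sup_{b>|x|}\frac1{b^n}\int_{B(0,b)}|f(y)|\,dy,\qquad Sf(x)=\int_{\mathbb R^n}\frac{f(y)}{|x|^n+|y|^n}\,dy,$$ where $B(0,b)$ is the ball of radius $b$ centered at the origin. Such an operator $T$ is of strong-type $(p(\cdot),p(\cdot))$ with respect to $w$ if there is $K>0$ such that $\|(Tf)w\|_{p(\cdot)}\le K\|fw\|_{p(\cdot)}$ for all non-negative $f\in L^{p(\cdot)}_w(\mathbb R^n)$. $w\in A_{p(\cdot),0}$ means there is $C>0$ such that $\|w\chi_{B(0,b)}\|_{p(\cdot)}\|w^{-1}\chi_{B(0,b)}\|_{p'(\cdot)}\le Cb^n$ for every $b>0$. *)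

(* Defs.v *)
From HB Require Import structures.
From mathcomp Require Import all_boot all_order all_algebra.
From mathcomp Require Import all_classical all_reals all_analysis.
From mathcomp Require Import measurable_realfun.
Import Order.TTheory GRing.Theory Num.Theory.
Import numFieldNormedType.Exports.

Set Implicit Arguments.
Unset Strict Implicit.
Unset Printing Implicit Defensive.

Local Open Scope classical_set_scope.
Local Open Scope ring_scope.
Local Open Scope ereal_scope.

(* The library has no Lebesgue measure on 'rV[R]_n.  It is built here from the
   Lebesgue outer measure (infimum of the total volume over countable covers by
   half-open boxes) through the library's Caratheodory construction. *)
Section lebesgue_outer_measure.
Context (R : realType) (n : nat).

Definition box (c : 'rV[R]_n * 'rV[R]_n) : set 'rV[R]_n :=
  [set x | forall i, (c.1 ord0 i < x ord0 i <= c.2 ord0 i)%R].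

Definition box_vol (c : 'rV[R]_n * 'rV[R]_n) : R :=
  (\prod_(i < n) (c.2 ord0 i - c.1 ord0 i))%R.

(* A cover is indexed by a subset D of nat, so that the empty family covers
   set0 also when n = 0. *)
Definition box_cover (A : set 'rV[R]_n)
    (Dc : set nat * (nat -> 'rV[R]_n * 'rV[R]_n)) : Prop :=
  (forall k i, (Dc.2 k).1 ord0 i <= (Dc.2 k).2 ord0 i)%R /\
  A `<=` \bigcup_(k in Dc.1) box (Dc.2 k).

Definition lebesgue_outer (A : set 'rV[R]_n) : \bar R :=
  ereal_inf [set \esum_(k in Dc.1) (box_vol (Dc.2 k))%:E | Dc in box_cover A].

Let vol_ge0 A Dc k : box_cover A Dc -> 0 <= (box_vol (Dc.2 k))%:E.
Proof.
by move=> [h _]; rewrite lee_fin prodr_ge0 // => i _; rewrite subr_ge0.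
Qed.

Lemma lebesgue_outer_ge0 A : 0 <= lebesgue_outer A.
Proof.
apply: le_ereal_inf_tmp => _ [Dc hc <-].
by apply: esum_ge0 => k _; exact: vol_ge0 hc.
Qed.

Lemma lebesgue_outer0 : lebesgue_outer set0 = 0.
Proof.
apply/eqP; rewrite eq_le lebesgue_outer_ge0 andbT.
apply: ereal_inf_lbound; exists (set0, fun=> (0%R, 0%R)); last by rewrite esum_set0.
by split.
Qed.

Lemma le_lebesgue_outer :
  {homo lebesgue_outer : A B / A `<=` B >-> A <= B}.
Proof.
move=> A B AB; apply: le_ereal_inf_tmp => _ [Dc [h1 h2] <-].
by apply: ereal_inf_lbound; exists Dc => //; split=> //; exact: subset_trans h2.
Qed.

Lemma lebesgue_outer_sigma_subadditive : sigma_subadditive lebesgue_outer.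
Proof.
move=> A; have [[i ioo]|] := pselect (exists i, lebesgue_outer (A i) = +oo).
  rewrite (eseries_pinfty _ _ ioo) ?leey// => k _.
  by rewrite -ltNye (lt_le_trans _ (lebesgue_outer_ge0 _)).
rewrite -forallNE => Aoo.
suff add2e (e : {posnum R}) : lebesgue_outer (\bigcup_k A k) <=
    \sum_(i <oo) lebesgue_outer (A i) + e%:num%:E.
  by apply/lee_addgt0Pr => _/posnumP[].
rewrite (le_trans _ (epsilon_trick _ _ _))//; last first.
  by move=> k; exact: lebesgue_outer_ge0.
pose P k Dc := box_cover (A k) Dc /\ \esum_(j in Dc.1) (box_vol (Dc.2 j))%:E
  <= lebesgue_outer (A k) + (e%:num / (2 ^ k.+1)%:R)%:E.
have [G PG] : {G & forall k, P k (G k)}.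
  apply: (@choice _ _ P) => k; rewrite /P.
  have fA : lebesgue_outer (A k) \is a fin_num.
    rewrite ge0_fin_numE ?lebesgue_outer_ge0// ltey; exact/eqP/Aoo.
  have ek : (0 < e%:num / (2 ^ k.+1)%:R)%R by [].
  have [x [Dc hc <-] xS] := lb_ereal_inf_adherent ek fA.
  by exists Dc; split => //; exact/ltW.
have /card_esym/ppcard_eqP[f] := card_nat2.
pose K := [set: nat] `*`` fun i => (G i).1.
apply: (@le_trans _ _
    (\esum_(k in K) (box_vol ((G k.1).2 k.2))%:E)).
  apply: ereal_inf_lbound.
  exists (f @^-1` K, fun k => (G (f k).1).2 (f k).2) => /=.
    split=> [k i|t [i _ Ait]] /=; first exact: (PG _).1.1.
    have [j Dj tj] := (PG i).1.2 _ Ait.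
    by exists (f^-1%FUN (i, j)) => /=; rewrite invK ?inE.
  rewrite (reindex_esum (f @^-1` K) K f) //; split=> // [x y _ _|y Ky].
    by apply: inj; rewrite inE.
  by exists (f^-1%FUN y) => /=; rewrite ?invK ?inE.
rewrite -(@esum_esum _ _ _ _ _ (fun i j => (box_vol ((G i).2 j))%:E)); last first.
  by move=> i j _ _; exact: vol_ge0 (PG i).1.
rewrite -nneseries_esumT; last first.
  by move=> i; apply: esum_ge0 => j _; exact: vol_ge0 (PG i).1.
apply: lee_nneseries => [i _ _|i _]; last exact: (PG i).2.
by apply: esum_ge0 => j _; exact: vol_ge0 (PG i).1.
Qed.

HB.instance Definition _ := isOuterMeasure.Build R 'rV[R]_n lebesgue_outer
  lebesgue_outer0 lebesgue_outer_ge0 le_lebesgue_outer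
  lebesgue_outer_sigma_subadditive.

End lebesgue_outer_measure.

(* 'rV[R]_n with the sigma-algebra of Lebesgue measurable sets. *)
Notation lebesgue_rV R n := (caratheodory_type (@lebesgue_outer R n)).

Section lebesgue_measure_rV.
Context (R : realType) (n : nat).

Definition leb (A : set (lebesgue_rV R n)) : \bar R := lebesgue_outer A.

Let leb0 : leb set0 = 0.
Proof. exact: lebesgue_outer0. Qed.

Let leb_ge0 A : 0 <= leb A.
Proof. exact: lebesgue_outer_ge0. Qed.

Let leb_sigma_additive : semi_sigma_additive leb.
Proof. exact: (@caratheodory_measure_sigma_additive _ _ (@lebesgue_outer R n)). Qed.

HB.instance Definition _ := isMeasure.Build _ (lebesgue_rV R n) R leb
  leb0 leb_ge0 leb_sigma_additive.

End lebesgue_measure_rV.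

Arguments leb R n : clear implicits.

Section variable_exponent.
Context (R : realType) (n : nat).
Local Notation V := (lebesgue_rV R n).
Local Notation mu := (leb R n).
Implicit Types (p r : V -> R) (f w : V -> \bar R).

(* The library norm on 'rV[R]_n is the sup norm. *)
Definition enorm (x : 'rV[R]_n) : R :=
  Num.sqrt (\sum_(i < n) x ord0 i ^+ 2)%R.

Definition eball (b : R) : set V := [set x | (enorm x < b)%R].

Definition exponent p : Prop :=
  [/\ measurable_fun [set: V] p, (forall x, 1 <= p x)%R &
      exists M : R, forall x, (p x <= M)%R].

Definition exp_inf p : \bar R := ereal_inf (range (EFin \o p)).
Definition exp_sup p : \bar R := ereal_sup (range (EFin \o p)).

(* The solution of 1 / p x + 1 / p' x = 1; meaningful only where 1 < p x
   (the infinite value at p x = 1 is not represented). *)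
Definition conj_exponent p : V -> R := fun x => (1 - (p x)^-1)^-1%R.

Definition LH0 p : Prop :=
  exists C0 p0 : R, [/\ (0 < C0)%R, (1 <= p0)%R &
    forall x : V, (0 < enorm x < 2^-1)%R ->
      (`|p x - p0| <= C0 / - ln (enorm x))%R].

Definition LHoo p : Prop :=
  exists Coo poo : R, [/\ (0 < Coo)%R, (1 <= poo)%R &
    forall x : V, (`|p x - poo| <= Coo / ln (expR 1 + enorm x))%R].

Definition vnorm r f : \bar R :=
  ereal_inf [set l%:E | l in [set l : R | (0 < l)%R /\
    \int[mu]_x (`|f x| / l%:E) `^ (r x) <= 1]].

Definition weight w : Prop :=
  [/\ measurable_fun [set: V] w, (forall x, 0 <= w x),
      (forall K : set 'rV[R]_n, compact K -> mu.-integrable K w) &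
      {ae mu, forall x, 0 < w x < +oo}].

Definition weighted_Lp p w f : Prop :=
  measurable_fun [set: V] f /\ vnorm p (fun x => f x * w x) < +oo.

Definition opN f : V -> \bar R := fun x =>
  ereal_sup [set ((b ^+ n)%:E)^-1 * \int[mu]_(y in eball b) `|f y|
            | b in [set b : R | (enorm x < b)%R]].

Definition opS f : V -> \bar R := fun x =>
  \int[mu]_y (f y / (enorm x ^+ n + enorm y ^+ n)%:E).

Definition strong_type (T : (V -> \bar R) -> V -> \bar R) p w : Prop :=
  exists K : R, (0 < K)%R /\
    forall f, (forall x, 0 <= f x) -> weighted_Lp p w f ->
      vnorm p (fun x => T f x * w x) <= K%:E * vnorm p (fun x => f x * w x).

Definition A_p0 p w : Prop :=
  exists C : R, (0 < C)%R /\ forall b : R, (0 < b)%R ->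
    vnorm p (fun x => w x * (\1_(eball b) x)%:E) *
    vnorm (conj_exponent p) (fun x => (w x)^-1 * (\1_(eball b) x)%:E)
      <= (C * b ^+ n)%:E.

End variable_exponent.

(* Main.v *)
(* (ii) => (i) is the pointwise bound [N f <= 2 S f].  (i) => (iii) tests [N] on
   [w^-1 (w^-1 / l)^(p' - 1)] over a ball, where [l] is below the norm of [w^-1].
   (iii) => (ii): on the annuli [A_k = {2^(k-1) <= |x| < 2^k}] let [W_k] and [S_k] be the
   norms of [w] and [w^-1] over [B(0, 2^k)].  Young's inequality on [A_k] and (iii) show
   that the annulus carries a fixed part of either norm, so [W_k] and [S_k] grow
   geometrically and [W_k S_j <= C th^|k-j| 2^(n max(j,k))].  As [S f] is at most
   [2^n sum_j 2^(-n max(j,k)) int_(A_j) f] on [A_k], the operator becomes a convolution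
   with a geometric kernel.  By log-Hoelder continuity at [0] and at infinity, [p] can be
   replaced on [A_k] by the constant [p_0] ([k < 0]) or [p_oo] ([k >= 0]) as long as the
   quantities raised to the power [p] are at least [h^|k|]; this is arranged by adding the
   summable sequence [h^|j|] to the modulars of [f w] over the annuli. *)
Require Import Defs.
From mathcomp Require Import all_boot all_order all_algebra.
From mathcomp Require Import all_classical all_reals all_analysis.
From mathcomp Require Import measurable_realfun ring lra zify.
Import Order.TTheory GRing.Theory Num.Theory.
Import numFieldNormedType.Exports.

Set Implicit Arguments.
Unset Strict Implicit.
Unset Printing Implicit Defensive.

Local Open Scope classical_set_scope.
Local Open Scope ring_scope.
Local Open Scope ereal_scope.

(** * Lebesgue measure of balls *)

(** A modular with variable exponent is not homogeneous, and no Hoelder inequality or interpolation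
    between constant exponents is invoked. Instead, Young's inequality is applied to functions
    divided by levels at which their modulars are at most [1]; after integration this bounds by
    products of levels with an absolute constant. Replacing [p] by a constant [q] on [A_k] costs a
    factor [s^((p - q) / q)]. Log-Hoelder continuity says exactly [|p - q| |k| <= L], which controls
    the factor by [h^(-L)] for [h^|k| <= s <= 1] but says nothing about smaller [s]; this is why a
    lower bound is forced on all quantities. Since [p_0] and [p_oo] may differ, the convolution must
    also carry powers [1 / q_j] to powers [1 / q_k] between negative and non-negative indices, and
    this uses up decay of the kernel. Hence the splitting [th = h^2]: one factor [h] pays for the
    change of exponent, the other is summed. The bound on [W_k S_j] is needed for [j < k] and for
    [j > k], so reverse doubling is proved for a pair of functions whose roles can be exchanged. *)

Lemma le_esumZ (R : realType) (T : choiceType) (D : set T) (a : T -> \bar R) s :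
  0 <= s -> (forall k, 0 <= a k) ->
  \esum_(k in D) (s * a k) <= s * \esum_(k in D) a k.
Proof.
move=> s0 a0; apply: ge_ereal_sup => _ [F FD <-]; rewrite -ge0_mule_fsumr//.
by rewrite lee_wpmul2l//; apply: ereal_sup_ubound; exists F.
Qed.

Section lebesgue_boxes.
Context (R : realType) (n : nat).
Implicit Types (c : 'rV[R]_n * 'rV[R]_n) (X : set 'rV[R]_n).

Let upd (x : 'rV[R]_n) (i : 'I_n) (a : R) : 'rV[R]_n :=
  \row_j (if j == i then a else x ord0 j).

(** The two pieces of a box cut by the hyperplane [x_i = a]. The cut is clamped to the side of the
    box: if the hyperplane misses the box, one piece is the whole box and the other has volume zero,
    and the sides stay ordered as [box_cover] demands. *)
Let boxl i (a : R) c :=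
  (c.1, upd c.2 i (Num.max (c.1 ord0 i) (Num.min (c.2 ord0 i) a))).
Let boxr i (a : R) c :=
  (upd c.1 i (Num.min (c.2 ord0 i) (Num.max (c.1 ord0 i) a)), c.2).

Lemma box_vol_split i (a : R) c : (c.1 ord0 i <= c.2 ord0 i)%R ->
  (box_vol (boxl i a c) + box_vol (boxr i a c) = box_vol c)%R.
Proof.
move=> c12; rewrite /box_vol (bigD1 i) //= [in X in (_ + X)%R](bigD1 i) //=.
rewrite [RHS](bigD1 i) //= !mxE eqxx.
under eq_bigr => j ji do rewrite mxE (negbTE ji).
under [in X in (_ + X)%R]eq_bigr => j ji do rewrite mxE (negbTE ji).
rewrite -mulrDl; congr (_ * _)%R.
set u := c.1 _ _ in c12 *; set v := c.2 _ _ in c12 *.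
have [av|va] := leP a v; have [ua|au] := leP u a.
- by rewrite (min_r av); ring.
- by rewrite (min_r c12); ring.
- by rewrite (max_r c12) (min_l (ltW va)); ring.
- by have := lt_trans va au; rewrite ltNge c12.
Qed.

(** Caratheodory's criterion: every box of a cover of [X] is cut along the hyperplane, the pieces
    cover the two parts of [X], and the volumes add up. *)
Lemma coord_measurable (i : 'I_n) (a : R) :
  measurable ([set x | (x ord0 i <= a)%R] : set (lebesgue_rV R n)).
Proof.
apply: le_caratheodory_measurable => X.
apply: le_ereal_inf_tmp => _ [[D c] [/= c12 Xc] <-].
have hl : box_cover (X `&` [set x | x ord0 i <= a]%R) (D, fun k => boxl i a (c k)).
  split => [k j|x [Xx xa]] /=.
    by rewrite mxE; case: eqVneq => [->|_]; rewrite ?le_max ?lexx.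
  have [k Dk xk] := Xc _ Xx; exists k => // j /=; rewrite mxE.
  have /andP[x1 x2] := xk j; case: eqVneq => [ji|_]; last by rewrite x1 x2.
  by subst j; rewrite x1 le_max le_min x2 xa orbT.
have hr : box_cover (X `&` ~` [set x | x ord0 i <= a]%R) (D, fun k => boxr i a (c k)).
  split => [k j|x [Xx /negP]] /=.
    by rewrite mxE; case: eqVneq => [->|_]; rewrite ?ge_min ?lexx.
  rewrite -ltNge => xa; have [k Dk xk] := Xc _ Xx; exists k => // j /=; rewrite mxE.
  have /andP[x1 x2] := xk j; case: eqVneq => [ji|_]; last by rewrite x1 x2.
  by subst j; rewrite x2 gt_min gt_max x1 xa orbT.
rewrite (eq_esum (b := fun k => (box_vol (boxl i a (c k)))%:E +
    (box_vol (boxr i a (c k)))%:E)); last first.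
  by move=> k _; rewrite -EFinD box_vol_split.
have vol0 c' : (forall j, c'.1 ord0 j <= c'.2 ord0 j)%R -> 0 <= (box_vol c')%:E.
  by move=> h; rewrite lee_fin prodr_ge0 // => j _; rewrite subr_ge0.
rewrite esumD; last 2 first.
- by move=> k _; apply: vol0; exact: hl.1.
- by move=> k _; apply: vol0; exact: hr.1.
by apply: leeD; apply: ereal_inf_lbound; [exists (D, fun k => boxl i a (c k))|
  exists (D, fun k => boxr i a (c k))].
Qed.

Lemma measurable_coord (i : 'I_n) :
  measurable_fun [set: lebesgue_rV R n] (fun x => x ord0 i).
Proof.
apply: (measurability (@RGenOInfty.G R)) => [|/= _ [_] [a] -> <-].
  exact: RGenOInfty.measurableE.
rewrite setTI.
have <- : ~` [set x : lebesgue_rV R n | (x ord0 i <= a)%R] =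
    (fun x : lebesgue_rV R n => x ord0 i) @^-1` `]a, +oo[%classic.
  by apply/seteqP; split=> x /=; rewrite in_itv/= andbT ltNge => /negP.
by apply: measurableC; exact: coord_measurable.
Qed.

End lebesgue_boxes.

Section balls.
Context (R : realType) (n : nat).
Local Notation V := (lebesgue_rV R n).
Local Notation mu := (leb R n).

Lemma measurable_enorm : measurable_fun [set: V] (@enorm R n).
Proof.
apply: (measurableT_comp (f := @Num.sqrt R)).
  apply: continuous_measurable_fun; exact: sqrt_continuous.
by apply: measurable_sum => i; apply: measurable_funX; exact: measurable_coord.
Qed.

Lemma measurable_eball b : measurable (eball b : set V).
Proof.
rewrite (_ : eball b = setT `&` @enorm R n @^-1` `]-oo, b[%classic).
  by apply: measurable_enorm => //; exact: measurable_itv.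
by rewrite setTI; apply/seteqP; split=> x /=; rewrite in_itv.
Qed.

Lemma enormZ (s : R) (x : 'rV[R]_n) : (0 <= s)%R -> enorm (s *: x) = (s * enorm x)%R.
Proof.
move=> s0; rewrite /enorm.
under eq_bigr do rewrite mxE exprMn.
by rewrite -mulr_sumr sqrtrM ?sqr_ge0// sqrtr_sqr ger0_norm.
Qed.

Lemma enorm_ge0 (x : 'rV[R]_n) : (0 <= enorm x)%R.
Proof. exact: sqrtr_ge0. Qed.

Lemma coord_le_enorm (x : 'rV[R]_n) i : (`|x ord0 i| <= enorm x)%R.
Proof.
rewrite -sqrtr_sqr ler_sqrt ?sumr_ge0// => [|j _]; last exact: sqr_ge0.
rewrite (bigD1 i)//= lerDl sumr_ge0// => j _; exact: sqr_ge0.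
Qed.

Lemma lebesgue_outer_scale_le (s : R) (A : set 'rV[R]_n) : (0 < s)%R ->
  lebesgue_outer [set x | A (s^-1 *: x)] <= (s ^+ n)%:E * lebesgue_outer A.
Proof.
move=> s0; have s'0 : (0 < s^-1)%R by rewrite invr_gt0.
have sn0 : (0 < s ^+ n)%R by rewrite exprn_gt0.
rewrite muleC -lee_pdivrMr//.
apply: le_ereal_inf_tmp => _ [[D c] [/= c12 Ac] <-].
rewrite lee_pdivrMr// muleC.
have vol0 k : 0 <= (box_vol (c k))%:E.
  by rewrite lee_fin prodr_ge0 // => j _; rewrite subr_ge0.
apply: (@le_trans _ _ (\esum_(k in D) (box_vol (s *: (c k).1, s *: (c k).2))%:E)).
  apply: ereal_inf_lbound; exists (D, fun k => (s *: (c k).1, s *: (c k).2)) => //.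
  split => [k i|x /Ac[k Dk xk]] /=; first by rewrite !mxE ler_pM2l.
  exists k => // i; have := xk i; rewrite /= !mxE.
  by rewrite ltr_pdivlMl// ler_pdivrMl.
rewrite (eq_esum (b := fun k => (s ^+ n)%:E * (box_vol (c k))%:E)); last first.
  move=> k _; rewrite -EFinM; congr (_%:E); rewrite /box_vol /=.
  under eq_bigr do rewrite !mxE -mulrBr.
  by rewrite big_split/= prodr_const card_ord.
apply: le_esumZ => //; exact: ltW.
Qed.

(** The missing inequality is the previous one for [s^-1] and the dilated set. *)
Lemma lebesgue_outer_scale (s : R) (A : set 'rV[R]_n) : (0 < s)%R ->
  lebesgue_outer [set x | A (s^-1 *: x)] = (s ^+ n)%:E * lebesgue_outer A.
Proof.
move=> s0; have s'0 : (0 < s^-1)%R by rewrite invr_gt0.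
have sn0 : (0 < s ^+ n)%R by rewrite exprn_gt0.
apply/eqP; rewrite eq_le lebesgue_outer_scale_le//=.
have := lebesgue_outer_scale_le [set x | A (s^-1 *: x)] s'0.
rewrite /= (_ : [set x | _] = A); last first.
  by apply/seteqP; split=> x /=; rewrite invrK scalerA mulVf ?gt_eqF// scale1r.
by rewrite exprVn muleC -lee_pdivrMr ?invr_gt0// invrK muleC.
Qed.

Lemma eball_scale (s b : R) : (0 < s)%R ->
  leb R n (eball (s * b)) = (s ^+ n)%:E * leb R n (eball b).
Proof.
move=> s0; rewrite -[RHS]lebesgue_outer_scale//; congr (lebesgue_outer _).
apply/seteqP; split=> x /=;
  by rewrite /eball /= enormZ ?invr_ge0 ?(ltW s0)// ltr_pdivrMl.
Qed.

(* Induction on the dimension by slicing: the weights [c] carry the indicator of the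
   last side, and integrating over the last coordinate restores its length. *)
Lemma unit_cube_cover (m : nat) (a b : nat -> nat -> R) (c : nat -> R) :
  (forall k, 0 <= c k)%R -> (forall k i, a k i <= b k i)%R ->
  (forall x : nat -> R, (forall i, 0 < x i <= 1)%R ->
    1 <= \sum_(k <oo) (c k * \prod_(i < m) ((a k i < x i <= b k i)%R)%:R)%:E) ->
  1 <= \sum_(k <oo) (c k * \prod_(i < m) (b k i - a k i))%:E.
Proof.
elim: m c => [|m IH] c c0 ab hc.
  have := hc (fun=> 1%R); under eq_eseriesr do rewrite big_ord0.
  under [in X in _ -> X]eq_eseriesr do rewrite big_ord0.
  by apply=> i; rewrite ltr01 lexx.
have key (t : R) : (0 < t <= 1)%R ->
  1 <= \sum_(k <oo) ((c k * \prod_(i < m) (b k i - a k i)) *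
     (t \in `]a k m, b k m])%:R)%:E.
  move=> t01; have := IH (fun k => c k * (t \in `]a k m, b k m])%:R)%R.
  under [in X in _ -> X]eq_eseriesr do rewrite mulrAC.
  apply=> // [k|x x01]; first by rewrite mulr_ge0.
  have := hc (fun i => if i == m then t else x i); rewrite (eq_eseriesr (g := fun k =>
    (c k * (t \in `]a k m, b k m])%:R * \prod_(i < m) ((a k i < x i <= b k i)%R)%:R)%:E)).
    by apply => i; case: ifP.
  move=> k _; rewrite big_ord_recr/= eqxx in_itv/= -mulrA; congr (_ * _)%:E.
  rewrite mulrC; congr (_ * _)%R.
  by apply: eq_bigr => i _; rewrite ltn_eqF.
have p0 k : (0 <= c k * \prod_(i < m) (b k i - a k i))%R.
  by rewrite mulr_ge0// prodr_ge0// => i _; rewrite subr_ge0.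
pose I : set R := `]0%R, 1%R]%classic.
have mI : measurable I by exact: measurable_itv.
have indE k t : ((t \in `]a k m, b k m])%:R = \1_(`]a k m, b k m]%classic) t :> R)%R.
  by rewrite indicE mem_setE.
have mi k : measurable_fun [set: R] (fun t => (t \in `]a k m, b k m])%:R : R).
  by under eq_fun do rewrite indE; exact: measurable_indic.
have mie k : measurable_fun I (fun t => ((t \in `]a k m, b k m])%:R)%:E : \bar R).
  by apply/measurable_EFinP; apply: measurable_funTS; exact: mi.
have -> : 1 = \int[lebesgue_measure]_(t in I) (cst 1) t :> \bar R.
  by rewrite integral_cst//= /I lebesgue_measure_itv/= lte01 oppr0 adde0 mul1e.
have mind k : measurable_fun [set: R] (fun t => (c k * \prod_(i < m) (b k i - a k i) *
     (t \in `]a k m, b k m])%:R)%:E).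
  apply/measurable_EFinP; exact: measurable_funM.
apply: (@le_trans _ _ (\int[lebesgue_measure]_(t in I) \sum_(k <oo)
    ((c k * \prod_(i < m) (b k i - a k i)) * (t \in `]a k m, b k m])%:R)%:E)).
  apply: ge0_le_integral => //=.
    apply: ge0_emeasurable_sum => [k x _ _|k _]; first by rewrite lee_fin mulr_ge0.
    by apply: measurable_funTS; exact: mind.
rewrite integral_nneseries//; last 2 first.
- by move=> k; apply: measurable_funTS; exact: mind.
- by move=> k t _; rewrite lee_fin mulr_ge0.
apply: lee_nneseries => [k _ _|k _].
  by apply: integral_ge0 => t _; rewrite lee_fin mulr_ge0.
under eq_integral do rewrite EFinM.
rewrite ge0_integralZl//=; last 2 first.
- exact: (mie k).
- by rewrite lee_fin.
rewrite big_ord_recr/= mulrA [leRHS]EFinM. apply: lee_wpmul2l; first by rewrite lee_fin.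
under eq_integral do rewrite indE.
rewrite integral_indic//= (le_trans (le_measure _ _ _ (@subIsetl _ _ _)))//= ?inE//.
  exact: measurableI.
by rewrite lebesgue_measure_itv/=; case: ifP => // _; rewrite lee_fin subr_ge0.
Qed.

Lemma lebesgue_outer_unit_cube :
  1 <= lebesgue_outer [set x : 'rV[R]_n | forall i, (0 < x ord0 i <= 1)%R].
Proof.
apply: le_ereal_inf_tmp => _ [[D c] [/= c12 Ac] <-].
(* Boxes with index outside [D] get weight [0], and [ext] turns row vectors into sequences, the form
   in which [unit_cube_cover] runs its induction. *)
pose e k : R := (k \in D)%:R.
pose ext (v : 'rV[R]_n) (j : nat) : R := if insub j is Some i then v ord0 i else 0%R.
have extE v (i : 'I_n) : ext v i = v ord0 i.
  by rewrite /ext; case: insubP => [j _ /val_inj ->|]//=; rewrite ltn_ord.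
have := @unit_cube_cover n (fun k => ext (c k).1) (fun k => ext (c k).2) e.
rewrite (eq_eseriesr (g := fun k => if k \in D then (box_vol (c k))%:E else 0)); last first.
  move=> k _; rewrite /e; case: ifP => _; rewrite ?mul0r// mul1r; congr (_%:E).
  by apply: eq_bigr => i _; rewrite !extE.
have vol0 k : 0 <= (box_vol (c k))%:E.
  by rewrite lee_fin prodr_ge0 // => j _; rewrite subr_ge0.
rewrite nneseries_esumT; last by move=> k; case: ifP.
rewrite -esum_mkcond; apply=> [k|k j|x x01].
- by rewrite /e.
- by rewrite /ext; case: insub.
have [|k Dk xk] := Ac (\row_i x i); first by move=> i; rewrite mxE x01.
pose u k := (e k * \prod_(i < n) ((ext (c k).1 i < x i <= ext (c k).2 i)%R)%:R)%:E.
have u0 j : 0 <= u j.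
  by rewrite /u lee_fin mulr_ge0 ?prodr_ge0// /e.
apply: le_trans (nneseries_lim_ge k.+1 (fun j _ _ => u0 j)).
rewrite big_nat_recr//= (_ : u k = 1); first by rewrite leeDr// sume_ge0.
rewrite /u /e mem_set// mul1r big1// => i _; have := xk i; rewrite !extE mxE.
by rewrite /= => ->.
Qed.

Lemma leb_eball_fin : leb R n (eball 1) < +oo.
Proof.
apply: (@le_lt_trans _ _ (2 ^+ n)%:E); last exact: ltry.
apply: ereal_inf_lbound; exists ([set 0%N], fun=> (const_mx (-1)%R, const_mx 1%R)).
  split=> [k i|x x1] /=; first by rewrite !mxE; lra.
  exists 0%N => // i; rewrite /= !mxE -ltrN2 opprK.
  have := coord_le_enorm x i; move: x1; rewrite /eball/= => x1 /le_lt_trans /(_ x1).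
  by rewrite ltr_norml => /andP[h1 h2]; apply/andP; split; lra.
rewrite esum_set1 ?lee_fin ?prodr_ge0//= => [|i _]; last by rewrite !mxE; lra.
congr (_%:E); rewrite /box_vol/=; under eq_bigr do rewrite !mxE.
by rewrite prodr_const card_ord; congr (_ ^+ _)%R; lra.
Qed.

(** By scaling, a null unit ball would make the ball of radius [n.+1] null; but that ball contains
    the unit cube, because [n < (n + 1)^2]. *)
Lemma leb_eball_gt0 : 0 < leb R n (eball 1).
Proof.
rewrite lt0e measure_ge0 andbT; apply/eqP => b0.
pose s : R := (n.+1)%:R.
have s0 : (0 < s)%R by rewrite ltr0n.
have : leb R n (eball s) = 0 by rewrite -[s]mulr1 eball_scale// b0 mule0.
apply/eqP; rewrite gt_eqF//; apply: (@lt_le_trans _ _ 1) => //.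
apply: le_trans lebesgue_outer_unit_cube _; apply: le_lebesgue_outer => x x01 /=.
rewrite /eball/= /enorm -[ltRHS]ger0_norm ?(ltW s0)// -sqrtr_sqr ltr_sqrt ?exprn_gt0//.
apply: (@le_lt_trans _ _ (\sum_(i < n) 1)%R).
  apply: ler_sum => i _; have /andP[x0 x1] := x01 i.
  by rewrite expr_le1// ltW.
by rewrite sumr_const card_ord /s -natrX ltr_nat -mulnn leq_pmulr.
Qed.

End balls.

(** * Modulars and variable-exponent norms *)

Section measure_facts.
Context d (T : measurableType d) (R : realType) (m : {measure set T -> \bar R}).
Implicit Types (f g : T -> \bar R) (r : T -> R).

(* Unlike [ge0_le_integral], no measurability: [opN f] and [opS f] are never shown
   to be measurable. *)
Lemma le_integral_lower f g : (forall x, 0 <= f x) -> (forall x, f x <= g x) ->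
  \int[m]_x f x <= \int[m]_x g x.
Proof.
move=> f0 fg; have g0 x : 0 <= g x by apply: le_trans (fg x).
rewrite !ge0_integralTE//; apply: ge_ereal_sup => _ [h /= hf <-].
by apply: ereal_sup_ubound; exists h => //= x; exact: le_trans (fg x).
Qed.

(** Away from the values [0] and [+oo] of [f] the power is [exp (r ln f)]; at these two values
    [r > 0] makes it [0] and [+oo]. *)
Lemma measurable_fun_poweR f r : (forall x, 0 <= f x) -> (forall x, 0 < r x)%R ->
  measurable_fun [set: T] f -> measurable_fun [set: T] r ->
  measurable_fun [set: T] (fun x => f x `^ r x).
Proof.
move=> f0 r0 mf mr.
have -> : (fun x => f x `^ r x) = (fun x => if f x == +oo then +oo else
    if f x == 0 then 0 else (expR (r x * ln (fine (f x))))%:E).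
  apply/funext => x; have := f0 x; case: (f x) => [y| |]//= y0.
    by rewrite /powR eqe (gt_eqF (r0 x)); case: ifP.
  by rewrite (gt_eqF (r0 x)).
apply: measurable_fun_ifT => //; first exact: measurable_fun_eqe.
apply: measurable_fun_ifT => //; first exact: measurable_fun_eqe.
apply/measurable_EFinP; apply: (@measurableT_comp _ _ _ _ _ _ (@expR R)) => //.
apply: measurable_funM => //; apply: (@measurableT_comp _ _ _ _ _ _ (@ln R)) => //.
exact: measurableT_comp.
Qed.

Lemma measurable_fun_inve f : (forall x, 0 <= f x) ->
  measurable_fun [set: T] f -> measurable_fun [set: T] (fun x => (f x)^-1).
Proof.
move=> f0 mf.
have -> : (fun x => (f x)^-1) = (fun x => if f x == +oo then 0 else
    if f x == 0 then +oo else (fine (f x) `^ (-1))%:E).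
  apply/funext => x; have := f0 x; case: (f x) => [y| |]//= y0.
    by rewrite inver eqe; case: ifP => //; rewrite powR_inv1.
apply: measurable_fun_ifT => //; first exact: measurable_fun_eqe.
apply: measurable_fun_ifT => //; first exact: measurable_fun_eqe.
apply/measurable_EFinP; apply: (@measurableT_comp _ _ _ _ _ _ (@powR R ^~ (-1)%R)) => //.
exact: measurableT_comp.
Qed.

Lemma measurable_fun_modular r f (l : R) : (forall x, 1 <= r x)%R ->
  measurable_fun [set: T] r -> measurable_fun [set: T] f -> (0 < l)%R ->
  measurable_fun [set: T] (fun x => (`|f x| / l%:E) `^ (r x)).
Proof.
move=> r1 mr mf l0; apply: measurable_fun_poweR => [x|x||].
- by rewrite mule_ge0// inve_ge0 lee_fin ltW.
- exact: lt_le_trans (r1 x).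
- under eq_fun do rewrite muleC.
  by apply: measurable_funeM; exact: measurableT_comp.
- exact: mr.
Qed.

Lemma ge0_integralZT (c : R) f : (0 <= c)%R -> (forall x, 0 <= f x) ->
  measurable_fun [set: T] f -> \int[m]_x (c%:E * f x) = c%:E * \int[m]_x f x.
Proof. by move=> c0 f0 mf; rewrite ge0_integralZl_EFin. Qed.

Lemma ge0_integral_eq0 f : (forall x, 0 <= f x) -> measurable_fun [set: T] f ->
  \int[m]_x f x = 0 -> {ae m, forall x, f x = 0}.
Proof.
move=> f0 mf f_eq0; have [+ _] := ae_eq_integral_abs m measurableT mf.
under eq_integral do rewrite gee0_abs//.
by move=> /(_ f_eq0); apply: filterS => x /= /(_ I).
Qed.

End measure_facts.

Section poweR_facts.
Context (R : realType).
Implicit Types (x y : \bar R) (a b c r s : R).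

Lemma le_poweR x y r : (0 <= r)%R -> 0 <= x -> x <= y -> x `^ r <= y `^ r.
Proof.
move=> r0 x0 xy; apply: gt0_ler_poweR => //; rewrite in_itv/= ?x0 ?leey//.
by rewrite (le_trans x0 xy).
Qed.

(** This bound and the next one replace homogeneity: a scalar below [1] leaves the power at worst as
    itself, a scalar above [1] at worst with the largest exponent. *)
Lemma poweR_scale_le1 x c r : (0 <= c <= 1)%R -> (1 <= r)%R -> 0 <= x ->
  (c%:E * x) `^ r <= c%:E * x `^ r.
Proof.
move=> /andP[c0 c1] r1 x0; rewrite poweRM//; apply: lee_wpmul2r; first exact: poweR_ge0.
rewrite poweR_EFin lee_fin; have [->|c_neq0] := eqVneq c 0%R.
  by rewrite powR0// gt_eqF// (lt_le_trans _ r1).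
by rewrite ge1r_powR// lt_neqAle eq_sym c_neq0 c0.
Qed.

Lemma poweR_scale_ge1 x c r s : (1 <= c)%R -> (r <= s)%R -> 0 <= x ->
  (c%:E * x) `^ r <= (c `^ s)%:E * x `^ r.
Proof.
move=> c1 rs x0; rewrite poweRM ?lee_fin ?(le_trans ler01)//.
by apply: lee_wpmul2r; rewrite ?poweR_ge0// poweR_EFin lee_fin ler_powR.
Qed.

End poweR_facts.

Section variable_norm.
Context (R : realType) (n : nat).
Local Notation V := (lebesgue_rV R n).
Local Notation mu := (leb R n).
Implicit Types (r : V -> R) (f g : V -> \bar R) (l : R).

Definition modular r f l := \int[mu]_x (`|f x| / l%:E) `^ (r x).

Lemma inve_EFin l : (0 < l)%R -> (l%:E)^-1 = (l^-1)%:E.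
Proof. by move=> l0; rewrite inver gt_eqF. Qed.

Lemma divl_ge0 f l x : (0 < l)%R -> 0 <= `|f x| / l%:E.
Proof. by move=> l0; rewrite mule_ge0// inve_ge0 lee_fin ltW. Qed.

Lemma modular_ge0 r f l : 0 <= modular r f l.
Proof. by apply: integral_ge0 => x _; exact: poweR_ge0. Qed.

Lemma vnorm_ge0 r f : 0 <= vnorm r f.
Proof. by apply: le_ereal_inf_tmp => _ [l [l0 _] <-]; rewrite lee_fin ltW. Qed.

Lemma vnorm_le r f l : (0 < l)%R -> modular r f l <= 1 -> vnorm r f <= l%:E.
Proof. by move=> l0 fl; apply: ereal_inf_lbound; exists l. Qed.

Lemma le_vnorm r f x : (forall l, (0 < l)%R -> modular r f l <= 1 -> x <= l%:E) ->
  x <= vnorm r f.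
Proof. by move=> h; apply: le_ereal_inf_tmp => _ [l [l0 fl] <-]; exact: h. Qed.

Lemma le_modular r f g l : (forall x, 0 <= r x)%R -> (0 < l)%R ->
  (forall x, `|f x| <= `|g x|) -> modular r f l <= modular r g l.
Proof.
move=> r0 l0 fg; apply: le_integral_lower => x; first exact: poweR_ge0.
apply: le_poweR => //; first exact: divl_ge0.
by apply: lee_wpmul2r => //; rewrite inve_ge0 lee_fin ltW.
Qed.

Lemma le_vnorm_fun r f g : (forall x, 0 <= r x)%R -> (forall x, `|f x| <= `|g x|) ->
  vnorm r f <= vnorm r g.
Proof.
move=> r0 fg; apply: le_vnorm => l l0 gl; apply: vnorm_le => //.
by apply: le_trans gl; exact: le_modular.
Qed.

Lemma modularZ r f c l : (0 < c)%R -> (0 < l)%R ->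
  modular r (fun x => c%:E * f x) (c * l) = modular r f l.
Proof.
move=> c0 l0; apply: eq_integral => x _; congr (_ `^ _).
rewrite abseM (gee0_abs (_ : 0 <= c%:E)) ?lee_fin ?(ltW c0)//.
by rewrite !inve_EFin ?mulr_gt0// invfM EFinM muleACA -EFinM divff ?mul1e// gt_eqF.
Qed.

Lemma vnormZ_le r f c : (0 < c)%R ->
  vnorm r (fun x => c%:E * f x) <= c%:E * vnorm r f.
Proof.
move=> c0; rewrite -lee_pdivrMl//; apply: le_vnorm => l l0 fl.
rewrite lee_pdivrMl// -EFinM; apply: vnorm_le; first exact: mulr_gt0.
by rewrite modularZ.
Qed.

Lemma modular_mono r f l l' : (forall x, 0 <= r x)%R -> (0 < l)%R -> (l <= l')%R ->
  modular r f l' <= modular r f l.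
Proof.
move=> r0 l0 ll'; have l'0 := lt_le_trans l0 ll'.
apply: le_integral_lower => x; first exact: poweR_ge0.
apply: le_poweR => //; first exact: divl_ge0.
by apply: lee_wpmul2l => //; rewrite !inve_EFin// lee_fin lef_pV2.
Qed.

Lemma modular_gt_vnorm r f l : (forall x, 0 <= r x)%R -> vnorm r f < l%:E ->
  modular r f l <= 1.
Proof.
move=> r0 /ereal_inf_lt[_ [l' [l'0 fl'] <-]]; rewrite lte_fin => l'l.
by apply: le_trans fl'; apply: modular_mono => //; exact: ltW.
Qed.

Lemma measurable_modular r f l : (forall x, 1 <= r x)%R -> measurable_fun [set: V] r ->
  measurable_fun [set: V] f -> (0 < l)%R ->
  measurable_fun [set: V] (fun x => (`|f x| / l%:E) `^ (r x)).
Proof. exact: measurable_fun_modular. Qed.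

(** Every level [c l] with [c > 1] is admissible, and going back from [c l] to [l] costs at most
    [c^M] because the exponent is bounded. The choice [c = (1 + e)^(1/M)] makes this cost
    [1 + e]. *)
Lemma vnorm_attained r f l M : (forall x, 1 <= r x <= M)%R ->
  measurable_fun [set: V] r -> measurable_fun [set: V] f ->
  (0 < l)%R -> vnorm r f <= l%:E -> modular r f l <= 1.
Proof.
move=> rM mr mf l0 fl.
have r1 x : (1 <= r x)%R by case/andP: (rM x).
have M0 : (0 < M)%R by have /andP[h1 h2] := rM point; rewrite (lt_le_trans ltr01)// (le_trans h1).
apply/lee_addgt0Pr => e e0; rewrite -EFinD.
pose c := ((1 + e) `^ M^-1)%R.
have c1 : (1 < c)%R.
  have <- : (1 `^ M^-1 = 1 :> R)%R by rewrite powR1.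
  by rewrite gt0_ltr_powR ?invr_gt0 ?ltrDl// nnegrE// addr_ge0// ltW.
have c0 : (0 < c)%R by rewrite (lt_trans ltr01).
have r0 x : (0 <= r x)%R by exact: le_trans (r1 x).
have h := @modular_gt_vnorm r f (c * l)%R r0.
have {}h : modular r f (c * l) <= 1.
  by apply: h; apply: le_lt_trans fl _; rewrite lte_fin ltr_pMl.
have -> : ((1 + e) = c `^ M)%R.
  by rewrite /c -powRrM mulVf ?gt_eqF// powRr1// addr_ge0// ltW.
apply: (@le_trans _ _ ((c `^ M)%:E * modular r f (c * l))); last first.
  by rewrite -[leRHS]mule1 lee_wpmul2l// lee_fin powR_ge0.
rewrite /modular -(ge0_integralZT _ (powR_ge0 _ _)); last 2 first.
- by move=> x; exact: poweR_ge0.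
- by apply: (measurable_modular r1 mr mf); exact: mulr_gt0.
apply: le_integral_lower => x; first exact: poweR_ge0.
apply: le_trans (poweR_scale_ge1 (ltW c1) _ _); last 2 first.
- by case/andP: (rM x).
- by apply: divl_ge0; exact: mulr_gt0.
apply: le_poweR; rewrite ?divl_ge0 ?(le_trans ler01)//.
rewrite muleCA lee_wpmul2l// !inve_EFin ?mulr_gt0// -EFinM lee_fin.
by rewrite invfM mulrA divff ?mul1r// gt_eqF.
Qed.

(** All levels [l < 1] are admissible, and exponents at least [1] turn this into a modular at level
    [1] of at most [l]; so the integrand vanishes almost everywhere. *)
Lemma vnorm_eq0 r f : (forall x, 1 <= r x)%R ->
  measurable_fun [set: V] r -> measurable_fun [set: V] f ->
  vnorm r f = 0 -> {ae mu, forall x, f x = 0}.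
Proof.
move=> r1 mr mf f0.
have h (l : R) : (0 < l)%R -> (l < 1)%R -> modular r f 1 <= l%:E.
  move=> l0 l1; have /modular_gt_vnorm fl : vnorm r f < l%:E by rewrite f0 lte_fin.
  apply: (@le_trans _ _ (l%:E * modular r f l)); last first.
    rewrite -[leRHS]mule1 lee_wpmul2l ?lee_fin ?(ltW l0)//.
    by apply: fl => x; exact: le_trans (r1 x).
  rewrite /modular -(ge0_integralZT _ (ltW l0)); last 2 first.
  - by move=> x; exact: poweR_ge0.
  - exact: (measurable_modular r1 mr mf l0).
  apply: le_integral_lower => x; first exact: poweR_ge0.
  apply: le_trans (poweR_scale_le1 _ (r1 x) (divl_ge0 _ _ l0)); last by rewrite !ltW.
  apply: le_poweR; rewrite ?divl_ge0 ?(le_trans ler01)//.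
  by rewrite muleCA lee_wpmul2l// !inve_EFin// -EFinM lee_fin divff ?gt_eqF// invr1.
have m0 : modular r f 1 = 0.
  apply/eqP; rewrite eq_le modular_ge0 andbT; apply/lee_addgt0Pr => e e0.
  rewrite add0e; apply: (@le_trans _ _ (Num.min e 2^-1)%:E).
    by apply: h; rewrite ?lt_min ?e0//= ?invr_gt0// gt_min; apply/orP; right; lra.
  by rewrite lee_fin ge_min lexx.
have := ge0_integral_eq0 (fun x => poweR_ge0 _ _) (measurable_modular r1 mr mf ltr01) m0.
apply: filterS => x /poweR_eq0_eq0.
by rewrite inve1 mule1 => /(_ (abse_ge0 _))/eqP; rewrite abse_eq0 => /eqP.
Qed.

End variable_norm.

(** * The implications (ii) => (i) and (i) => (iii) *)

Lemma measurable_fun_conj d (T : measurableType d) (R : realType) (p : T -> R) :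
  (forall x, 1 < p x)%R -> measurable_fun [set: T] p ->
  measurable_fun [set: T] (fun x => (1 - (p x)^-1)^-1)%R.
Proof.
move=> p1 mp.
have -> : (fun x => (1 - (p x)^-1)^-1)%R = (fun x => (1 - p x `^ (-1)) `^ (-1))%R.
  apply/funext => x; have p0 := lt_trans ltr01 (p1 x).
  by rewrite (powR_inv1 (ltW p0)) powR_inv1// subr_ge0 invf_le1// ltW.
apply: (@measurableT_comp _ _ _ _ _ _ (@powR R ^~ (-1)%R)); first exact: measurable_powR.
apply: measurable_funB => //.
exact: (@measurableT_comp _ _ _ _ _ _ (@powR R ^~ (-1)%R)).
Qed.

Section exponents.
Context (R : realType) (n : nat).
Local Notation V := (lebesgue_rV R n).
Implicit Types (p : V -> R).

Lemma exponent_bounds p : exponent p -> 1 < exp_inf p ->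
  exists a M : R, (1 < a)%R /\ forall x, (a <= p x <= M)%R.
Proof.
move=> [_ p1 [M pM]] pinf.
have infp x : exp_inf p <= (p x)%:E by apply: ereal_inf_lbound; exists x.
have fin : exp_inf p \is a fin_num.
  by rewrite ge0_fin_numE ?(le_trans _ (ltW pinf))// (le_lt_trans (infp point))// ltry.
exists (fine (exp_inf p)), M; split; first by rewrite -lte_fin fineK.
by move=> x; rewrite pM andbT -lee_fin fineK.
Qed.

(** A lower bound [a > 1] on [p] is an upper bound on the conjugate exponent, namely the conjugate
    of [a]. *)
Lemma conj_exponent_bounds p (a M : R) : (1 < a)%R ->
  (forall x, a <= p x <= M)%R ->
  forall x, (1 <= conj_exponent p x <= (1 - a^-1)^-1)%R.
Proof.
move=> a1 pa x; have /andP[ax _] := pa x.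
have p1 := lt_le_trans a1 ax; have p0 := lt_trans ltr01 p1; have a0 := lt_trans ltr01 a1.
have pi : (0 < (p x)^-1)%R by rewrite invr_gt0.
have pia : ((p x)^-1 <= a^-1)%R by rewrite lef_pV2.
have ai : (a^-1 < 1)%R by rewrite invf_lt1.
rewrite /conj_exponent; apply/andP; split; first by rewrite invf_ge1//; lra.
by rewrite lef_pV2 ?posrE; lra.
Qed.

Lemma measurable_conj_exponent p : (forall x, 1 < p x)%R ->
  measurable_fun [set: V] p -> measurable_fun [set: V] (conj_exponent p).
Proof. exact: measurable_fun_conj. Qed.

End exponents.

Section easy_implications.
Context (R : realType) (n : nat).
Local Notation V := (lebesgue_rV R n).
Local Notation mu := (leb R n).
Implicit Types (f w : V -> \bar R) (p : V -> R).

Lemma opN_ge0 f x : 0 <= opN f x.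
Proof.
apply: le_ereal_sup_tmp; have e0 := enorm_ge0 x.
exists (((enorm x + 1) ^+ n)%:E^-1 * \int[mu]_(y in eball (enorm x + 1)) `|f y|).
  by exists (enorm x + 1)%R => //=; rewrite ltrDl.
apply: mule_ge0; last by apply: integral_ge0.
by rewrite inve_ge0 lee_fin exprn_ge0// addr_ge0.
Qed.

Lemma opS_ge0 f x : (forall y, 0 <= f y) -> 0 <= opS f x.
Proof.
move=> f0; apply: integral_ge0 => y _; apply: mule_ge0 => //.
by rewrite inve_ge0 lee_fin addr_ge0// exprn_ge0// enorm_ge0.
Qed.

(** For [|x| < b] and [|y| < b] the denominator [|x|^n + |y|^n] of [S] is at most [2 b^n]. *)
Lemma opN_le_opS f x : (forall y, 0 <= f y) -> measurable_fun [set: V] f ->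
  opN f x <= 2%:E * opS f x.
Proof.
move=> f0 mf; apply: ge_ereal_sup => _ [b /= xb <-].
have b0 : (0 < b)%R by apply: le_lt_trans xb; exact: enorm_ge0.
have bn0 : (0 < b ^+ n)%R by rewrite exprn_gt0.
rewrite inve_EFin// muleC lee_pdivrMr// integral_mkcond.
rewrite muleC.
have -> : (b ^+ n)%:E * (2%:E * opS f x) = (b ^+ n * 2)%:E * opS f x by rewrite EFinM muleA.
rewrite -lee_pdivrMl ?mulr_gt0// -ge0_integralZT; last 3 first.
- by rewrite invr_ge0 mulr_ge0// ltW.
- by move=> y; apply: erestrict_ge0.
- apply/(measurable_restrictT _ (measurable_eball _)).
  by apply: measurable_funTS; exact: measurableT_comp.
apply: le_integral_lower => y.
  by rewrite mule_ge0// ?erestrict_ge0// lee_fin invr_ge0 mulr_ge0// ltW.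
rewrite patchE; case: ifPn => [|_]; last first.
  by rewrite mule0 mule_ge0// inve_ge0 lee_fin addr_ge0// exprn_ge0// enorm_ge0.
rewrite inE /eball/= => yb; rewrite (gee0_abs (f0 y)) muleC; apply: lee_wpmul2l => //.
have yn : (enorm x ^+ n + enorm y ^+ n <= b ^+ n * 2)%R.
  by rewrite mulr_natr mulr2n lerD// lerXn2r// ?nnegrE ?enorm_ge0// ltW.
have xy0 : (0 <= enorm x ^+ n + enorm y ^+ n)%R.
  by rewrite addr_ge0// exprn_ge0// enorm_ge0.
(* A vanishing denominator has inverse [+oo], and the bound is then trivial. *)
rewrite inver; case: ifPn => [|xy_neq0]; first by rewrite leey.
by rewrite lee_fin lef_pV2// posrE ?mulr_gt0// lt0r xy_neq0.
Qed.

Lemma strong_type_opS_opN p w : (forall x, 0 <= p x)%R -> (forall x, 0 <= w x) ->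
  strong_type (@opS R n) p w -> strong_type (@opN R n) p w.
Proof.
move=> p0 w0 [K [K0 hK]]; exists (2 * K)%R; split; first by rewrite mulr_gt0.
move=> f f0 fw; apply: (@le_trans _ _ (2%:E * vnorm p (fun x => opS f x * w x))).
  apply: le_trans (vnormZ_le _ _ _) => //; apply: le_vnorm_fun => // x.
  rewrite !gee0_abs; first last.
  - by rewrite mule_ge0// opN_ge0.
  - by rewrite !mule_ge0// opS_ge0.
  by rewrite muleA lee_wpmul2r// opN_le_opS//; case: fw.
by rewrite EFinM -muleA lee_wpmul2l// hK.
Qed.

Lemma le_ereal_lt_pos (y : \bar R) (X : R) : (0 <= X)%R ->
  (forall l : R, (0 < l)%R -> l%:E < y -> (l <= X)%R) -> y <= X%:E.
Proof.
move=> X0 h; rewrite leNgt; apply/negP => Xy.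
case: y => [y| |] // in h Xy *.
  move: Xy; rewrite lte_fin => Xy.
  have X1 : (0 < (X + y) / 2)%R by lra.
  have X2 : ((X + y) / 2 < y)%R by lra.
  by have := h _ X1; rewrite lte_fin => /(_ X2); lra.
have X1 : (0 < X + 1)%R by lra.
by have := h _ X1 (ltry _); lra.
Qed.

End easy_implications.

Section ball_volume.
Context (R : realType) (n : nat).
Local Notation mu := (leb R n).

Lemma leb_eball b : (0 < b)%R -> mu (eball b) = (b ^+ n)%:E * mu (eball 1).
Proof. by move=> b0; rewrite -eball_scale// mulr1. Qed.

Lemma leb_eball_lty b : (0 < b)%R -> mu (eball b) < +oo.
Proof.
move=> b0; rewrite leb_eball// lte_mul_pinfty ?lee_fin ?exprn_ge0 ?ltW//.
exact: leb_eball_fin.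
Qed.

End ball_volume.

(** * Cutting off where the weight is too small or too large *)

Section truncation.
Context d (T : measurableType d) (R : realType) (m : {measure set T -> \bar R}).
Implicit Types (f w : T -> \bar R).

Definition between w (k : nat) : set T :=
  [set x | (k.+1%:R^-1)%:E <= w x <= (k.+1%:R)%:E].

Lemma measurable_between w k : measurable_fun [set: T] w -> measurable (between w k).
Proof.
move=> mw; rewrite (_ : between w k = (setT `&` w @^-1` `[(k.+1%:R^-1)%:E, (k.+1%:R)%:E]%classic)).
  by apply: mw => //; exact: emeasurable_itv.
by rewrite setTI; apply/seteqP; split=> x; rewrite /between/= in_itv.
Qed.

Lemma between_nondecreasing w : nondecreasing_seq (between w).
Proof.
move=> k l kl; apply/subsetPset => x /andP[h1 h2]; apply/andP; split.
  by apply: le_trans h1; rewrite lee_fin lef_pV2 ?posrE// ler_nat.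
by apply: le_trans h2 _; rewrite lee_fin ler_nat.
Qed.

Lemma bigcup_between w x : 0 < w x < +oo -> (\bigcup_k between w k) x.
Proof.
case wx: (w x) => [u| |]//; last by rewrite ltxx andbF.
rewrite lte_fin => /andP[u0 _].
have u'0 : (0 <= Num.max u u^-1)%R by rewrite le_max ltW.
exists (Num.truncn (Num.max u u^-1)%R) => //.
have /andP[_] := truncn_itv u'0; rewrite gt_max => /andP[h1 h2].
rewrite /between/= wx !lee_fin (ltW h1) andbT.
by rewrite -[leRHS]invrK lef_pV2 ?posrE ?invr_gt0// ltW.
Qed.

(** The sets [between w k] increase to a set of full measure; if all integrals over them were at
    most [1], monotone convergence would bound the whole integral by [1]. *)
Lemma integral_between_gt1 w f : measurable_fun [set: T] w ->
  {ae m, forall x, 0 < w x < +oo} -> (forall x, 0 <= f x) ->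
  measurable_fun [set: T] f -> 1 < \int[m]_x f x ->
  exists k, 1 < \int[m]_(x in between w k) f x.
Proof.
move=> mw aew f0 mf; apply: contraPP => /forallNP h; apply/negP; rewrite -leNgt.
have mU : measurable (\bigcup_k between w k).
  by apply: bigcup_measurable => k _; exact: measurable_between.
have -> : \int[m]_x f x = \int[m]_(x in \bigcup_k between w k) f x.
  rewrite [RHS]integral_mkcond; apply: ge0_ae_eq_integral => //.
  - by apply/(measurable_restrictT _ mU); exact: measurable_funTS.
  - by move=> x _; exact: erestrict_ge0.
  - apply: filterS aew => x /bigcup_between wx _.
    by rewrite patchE mem_set.
have mb k : measurable (between w k) by exact: measurable_between.
have cv := @ge0_nondecreasing_set_cvg_integral _ _ _ (between w) f m
  (between_nondecreasing w) mb (fun k => measurable_funTS mf) (fun k x _ => f0 x).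
rewrite -(cvg_lim _ cv)//; apply: lime_le; first by apply/cvg_ex; eexists; exact: cv.
by apply: nearW => k; rewrite leNgt; apply/negP; exact: h.
Qed.

End truncation.

(** * The test function for [N] *)

Section necessity.
Context (R : realType) (n : nat).
Local Notation V := (lebesgue_rV R n).
Local Notation mu := (leb R n).
Implicit Types (f w : V -> \bar R) (p : V -> R).

(** With [t = u^-1 / a] and [q] the conjugate of [p], the base is [t^(q - 1)], and [(q - 1) p = q].
    Thus the modular of the test function times [w] equals that of [w^-1]. *)
Lemma conj_test_function (u a p : R) : (0 < u)%R -> (0 < a)%R -> (1 < p)%R ->
  ((a * (u^-1 / a) `^ (1 - p^-1)^-1 * u) `^ p = (u^-1 / a) `^ (1 - p^-1)^-1)%R.
Proof.
move=> u0 a0 p1; set q := ((1 - p^-1)^-1)%R; set t := (u^-1 / a)%R.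
have t0 : (0 < t)%R by rewrite divr_gt0// invr_gt0.
have p0 := lt_trans ltr01 p1.
have pi : (p^-1 < 1)%R by rewrite invf_lt1.
have -> : (a * t `^ q * u = t `^ (q - 1))%R.
  rewrite powRB ?(gt_eqF t0) ?implybT// powRr1 ?(ltW t0)// /t.
  by rewrite invfM !invrK; ring.
rewrite -powRrM; congr (_ `^ _)%R; rewrite /q; field; rewrite ?gt_eqF// subr_gt0//.
Qed.

Lemma opN_ge_mean f b x : (enorm x < b)%R ->
  ((b ^+ n)%:E)^-1 * \int[mu]_(y in eball b) `|f y| <= opN f x.
Proof. by move=> xb; apply: ereal_sup_ubound; exists b. Qed.

(* Test function [l (w^-1 / l)^p'], cut off to [1 / k <= w <= k] so that its modular
   is finite. *)
Lemma strong_type_opN_Ap0 p w (a M : R) : measurable_fun [set: V] p ->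
  (1 < a)%R -> (forall x, a <= p x <= M)%R -> weight w ->
  strong_type (@opN R n) p w -> A_p0 p w.
Proof.
move=> mp a1 pa [mw w0 _ aew] [K [K0 hK]]; exists K; split => // b b0.
have p1 x : (1 < p x)%R by have /andP[h _] := pa x; exact: lt_le_trans h.
have p0 x : (0 < p x)%R by exact: lt_trans (p1 x).
set p' := conj_exponent p.
have p'1 x : (1 <= p' x)%R by have /andP[] := conj_exponent_bounds a1 pa x.
have p'0 x : (0 < p' x)%R by exact: lt_le_trans (p'1 x).
set M' := ((1 - a^-1)^-1)%R.
have p'M x : (p' x <= M')%R by have /andP[] := conj_exponent_bounds a1 pa x.
have mp' : measurable_fun [set: V] p' by exact: measurable_conj_exponent.
set B := eball b; have mB : measurable (B : set V) by exact: measurable_eball.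
have bn0 : (0 < b ^+ n)%R by rewrite exprn_gt0.
have mind : measurable_fun [set: V] (fun x => (\1_B x)%:E : \bar R).
  by apply/measurable_EFinP; exact: measurable_indic.
set h := fun x => (w x)^-1 * (\1_B x)%:E.
have h0 x : 0 <= h x by rewrite mule_ge0// inve_ge0.
have mh : measurable_fun [set: V] h.
  by apply: emeasurable_funM; [exact: measurable_fun_inve|exact: mind].
set J := vnorm p _; set I := vnorm _ h.
have J0 : 0 <= J by exact: vnorm_ge0.
have I0 : 0 <= I by exact: vnorm_ge0.
(* It suffices to treat levels [l] strictly below [I]; neither norm has to be known finite. If
   [J = +oo], the bound leaves no such [l], so [I = 0] and the product is [0]. *)
suff key (l : R) : (0 < l)%R -> l%:E < I -> J * l%:E <= (K * b ^+ n)%:E.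
  case: (J) J0 key => [j| |]// J0 key.
    have [->|j0] := eqVneq j 0%R; first by rewrite mul0e lee_fin mulr_ge0 ?(ltW K0) ?ltW.
    have j_gt0 : (0 < j)%R by rewrite lt_neqAle eq_sym j0.
    rewrite -lee_pdivlMl// -EFinM; apply: le_ereal_lt_pos.
      by rewrite mulr_ge0 ?invr_ge0 ?mulr_ge0 ?ltW.
    by move=> l l0 /(key _ l0); rewrite -EFinM lee_fin -ler_pdivlMl.
  have [->|/eqP I_neq0] := eqVneq I 0; first by rewrite mule0 lee_fin mulr_ge0 ?ltW.
  exfalso; apply: I_neq0; apply/eqP; rewrite eq_le I0 andbT.
  apply: le_ereal_lt_pos => // l l0 /(key _ l0).
  by rewrite gt0_mulye ?lte_fin.
move=> l0 lI.
pose g x := (`|h x| / l%:E) `^ (p' x).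
have g0 x : 0 <= g x by exact: poweR_ge0.
have mg : measurable_fun [set: V] g by exact: measurable_modular.
have : 1 < \int[mu]_x g x.
  rewrite ltNge; apply/negP => g1.
  by move: lI; rewrite ltNge (vnorm_le l0 g1).
move=> /(integral_between_gt1 mw aew g0 mg)[k].
have mE : measurable (between w k) by exact: measurable_between.
have gB x : ~ B x -> g x = 0.
  move=> Bx; rewrite /g /h indicE memNset// mule0 abse0 mul0e poweR0r// gt_eqF//.
rewrite integral_mkcond; set gE := g \_ (between w k); set rho := \int[mu]_x gE x => rho1.
have gE0 x : 0 <= gE x by exact: erestrict_ge0.
have mgE : measurable_fun [set: V] gE.
  by apply/(measurable_restrictT _ mE); exact: measurable_funTS.
have gEB x : ~ B x -> gE x = 0 by rewrite /gE patchE => /gB ->; case: ifP.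
have rho_fin : rho < +oo.
  (* Where [w >= 1 / (k + 1)], the base [w^-1 / l] is at most [(k + 1) / l]; the maximum with [1]
     allows [p'] to be replaced by its bound [M']. *)
  pose c := Num.max 1%R (k.+1%:R / l)%R.
  have c1 : (1 <= c)%R by rewrite le_max lexx.
  apply: (@le_lt_trans _ _ (\int[mu]_x ((c `^ M')%:E * (\1_B x)%:E))); last first.
    rewrite ge0_integralZT ?powR_ge0//.
    rewrite integral_indic// setIT lte_mul_pinfty ?lee_fin ?powR_ge0//.
    exact: leb_eball_lty.
  apply: le_integral_lower => // x.
  have [Bx|Bx] := pselect (B x); last by rewrite gEB// mule_ge0// lee_fin powR_ge0.
  rewrite /gE patchE; case: ifPn => [|_]; last by rewrite mule_ge0// lee_fin powR_ge0.
  rewrite inE /between/= => /andP[wk _].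
  rewrite /g /h indicE mem_set// !mule1 gee0_abs ?inve_ge0//.
  apply: (@le_trans _ _ ((c%:E) `^ p' x)); last first.
    by rewrite poweR_EFin lee_fin ler_powR.
  apply: le_poweR; first exact: ltW.
    by rewrite mule_ge0 ?inve_ge0// lee_fin ltW.
  apply: (@le_trans _ _ ((k.+1%:R / l)%:E)); last by rewrite lee_fin le_max lexx orbT.
  rewrite inve_EFin// EFinM lee_wpmul2r ?lee_fin ?invr_ge0 ?(ltW l0)//.
  by rewrite -[leRHS]inveK inve_EFin// lee_pV2 ?inE//.
have rhoE : rho = (fine rho)%:E by rewrite fineK// ge0_fin_numE// ltW// (lt_trans lte01).
set r := fine rho in rhoE.
have r1 : (1 < r)%R by rewrite -lte_fin -rhoE.
have r0 : (0 < r)%R by exact: lt_trans r1.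
pose f x := l%:E * gE x.
have f0 x : 0 <= f x by rewrite mule_ge0// lee_fin ltW.
have mf : measurable_fun [set: V] f by exact: measurable_funeM.
have fwE x : (f x * w x) `^ p x = gE x.
  rewrite /f /gE patchE; case: ifPn => [|_]; last first.
    by rewrite mule0 mul0e poweR0r// gt_eqF.
  rewrite inE => wk.
  have [Bx|Bx] := pselect (B x); last first.
    by rewrite gB// mule0 mul0e poweR0r// gt_eqF.
  rewrite /g /h indicE mem_set// mule1.
  move: wk; rewrite /between/=; case: (w x) => [u| |]//; last by rewrite leye_eq andbF.
  rewrite lee_fin => /andP[u1 _].
  have u0 : (0 < u)%R by apply: lt_le_trans u1; rewrite invr_gt0.
  rewrite !inve_EFin// gee0_abs ?lee_fin ?invr_ge0 ?(ltW u0)// -EFinM poweR_EFin.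
  by rewrite -!EFinM poweR_EFin conj_test_function.
(* The modular of [f w] at level [1] is [r > 1], and [p >= 1] gives [r^(-p) <= r^-1], so the level
   [r] is admissible. *)
have fw_r : vnorm p (fun x => f x * w x) <= r%:E.
  apply: vnorm_le => //.
  apply: (@le_trans _ _ (\int[mu]_x (r^-1%:E * gE x))); last first.
    rewrite ge0_integralZT ?invr_ge0 ?(ltW r0)// -/rho rhoE -EFinM mulVf//.
    by rewrite gt_eqF.
  apply: le_integral_lower => x; first exact: poweR_ge0.
  rewrite -(fwE x) (gee0_abs (mule_ge0 (f0 x) (w0 x))) (inve_EFin r0) muleC.
  apply: (poweR_scale_le1 _ (ltW (p1 x)) (mule_ge0 (f0 x) (w0 x))).
  by rewrite invr_ge0 (ltW r0) invf_le1 ?ltW.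
have mean x : B x -> ((b ^+ n)^-1 * (l * r))%:E <= opN f x.
  move=> Bx; apply: le_trans (opN_ge_mean f Bx).
  rewrite inve_EFin// EFinM lee_wpmul2l ?lee_fin ?invr_ge0 ?(ltW bn0)//.
  rewrite integral_mkcond EFinM -rhoE /rho -(ge0_integralZT _ (ltW l0))//.
  apply: le_integral_lower => // x'; rewrite patchE -/(f x'); case: ifPn.
    by rewrite gee0_abs.
  by rewrite notin_setE => /gEB; rewrite /f => ->; rewrite mule0.
(* On [B] the function [N f] is at least [c], while the strong type bounds the norm of [(N f) w] by
   [K r]; the unknown [r] is a factor of both and cancels. *)
set c := ((b ^+ n)^-1 * (l * r))%R in mean.
have c0 : (0 < c)%R by rewrite mulr_gt0 ?invr_gt0// mulr_gt0.
have Jle : J <= (c^-1)%:E * (K * r)%:E.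
  apply: (@le_trans _ _ ((c^-1)%:E * vnorm p (fun x => c%:E * (w x * (\1_B x)%:E)))).
    rewrite /J; have <- : (fun x => (c^-1)%:E * (c%:E * (w x * (\1_B x)%:E))) =
      (fun x => w x * (\1_(eball b) x)%:E).
      by apply/funext => x; rewrite muleA -EFinM mulVf ?mul1e// gt_eqF.
    by apply: vnormZ_le; rewrite invr_gt0.
  apply: lee_wpmul2l; first by rewrite lee_fin invr_ge0 ltW.
  apply: (@le_trans _ _ (vnorm p (fun x => opN f x * w x))).
    apply: le_vnorm_fun => [x|x]; first exact: ltW.
    rewrite !gee0_abs; first last.
    - by rewrite mule_ge0// ?lee_fin ?(ltW c0)// mule_ge0.
    - by rewrite mule_ge0// opN_ge0.
    have [Bx|Bx] := pselect (B x); last first.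
      by rewrite indicE memNset// !mule0 mule_ge0// opN_ge0.
    by rewrite indicE mem_set// mule1 lee_wpmul2r// mean.
  apply: (le_trans (hK f f0 _)); first by split => //; apply: le_lt_trans fw_r _; exact: ltry.
  by rewrite EFinM lee_wpmul2l// lee_fin ltW.
apply: (@le_trans _ _ ((c^-1)%:E * (K * r)%:E * l%:E)); first by rewrite lee_wpmul2r// lee_fin ltW.
rewrite -!EFinM lee_fin /c le_eqVlt; apply/orP; left; apply/eqP.
by field; rewrite !gt_eqF.
Qed.

End necessity.

(** * Dyadic annuli *)

(** Enumerates the integers as [0, -1, 1, -2, 2, ...], so that sums over all annuli become series
    over [nat]. *)
Definition zig (m : nat) : int := if odd m then Negz m./2 else Posz m./2.

Lemma zig_bij : bijective zig.
Proof.
exists (fun z => match z with Posz k => k.*2 | Negz k => k.*2.+1 end).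
- move=> m; rewrite /zig; case: ifP => om; rewrite -[RHS]odd_double_half om//.
- by case=> k; rewrite /zig /= ?odd_double /= ?doubleK ?uphalf_double.
Qed.

Lemma leq_absz_zig m : (m <= (`|zig m|%N).*2)%N.
Proof. rewrite /zig; case: ifP => om; rewrite -{1}[m]odd_double_half om /=; lia. Qed.

Definition zdist (k j : nat) : nat := `|zig k - zig j|%N.

Section geometric_sums.
Context (R : realType).
Implicit Types (x : R) (u : nat -> \bar R).

Lemma nneseries_le u y : (forall k, 0 <= u k) ->
  (forall n, \sum_(0 <= k < n) u k <= y) -> \sum_(k <oo) u k <= y.
Proof.
by move=> u0 uy; apply: lime_le; [exact: is_cvg_nneseries|exact: nearW].
Qed.

Lemma nneseries_geometric_le x : (0 <= x < 1)%R ->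
  \sum_(k <oo) (x ^+ k)%:E <= ((1 - x)^-1)%:E.
Proof.
move=> /andP[x0 x1]; apply: nneseries_le => [k|n]; first by rewrite lee_fin exprn_ge0.
have x1' : (0 < 1 - x)%R by rewrite subr_gt0.
rewrite sumEFin lee_fin -[leRHS]mul1r ler_pdivlMr//.
suff -> : ((\sum_(0 <= k < n) x ^+ k) * (1 - x) = 1 - x ^+ n)%R.
  by rewrite gerBl exprn_ge0.
elim: n => [|n IH]; first by rewrite big_geq// mul0r expr0 subrr.
by rewrite big_nat_recr//= mulrDl IH exprS; ring.
Qed.

Lemma nneseries_zig_shift (u : int -> \bar R) l : (forall k, 0 <= u k) ->
  \sum_(m <oo) u (zig m - l)%R = \sum_(m <oo) u (zig m).
Proof.
move=> u0; have bij := zig_bij.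
have setb (f : nat -> int) : bijective f -> set_bij [set: nat] [set: int] f.
  move=> [g fK gK]; split=> [x //|x y _ _ /(can_inj fK)//|y _].
  by exists (g y).
rewrite !nneseries_esumT//.
rewrite -(reindex_esum [set: nat] [set: int] zig u (setb _ bij)).
rewrite -(reindex_esum [set: nat] [set: int] (fun m => (zig m - l)%R) u)//.
have bijB : bijective (fun z : int => (z - l)%R).
  by exists (fun z => (z + l)%R) => z; rewrite ?addrK ?subrK.
by apply: setb; exact: bij_comp bijB bij.
Qed.

(** Since [m <= 2 |zig m|], one has [(x^2)^|zig m| <= x^m]. This is why kernels over the integers
    are given a ratio that is a square. *)
Lemma nneseries_absz_zig x l : (0 <= x < 1)%R ->
  \sum_(m <oo) ((x ^+ 2) ^+ `|(zig m - l)%R|%N)%:E <= ((1 - x)^-1)%:E.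
Proof.
move=> /andP[x0 x1].
rewrite (@nneseries_zig_shift (fun z => ((x ^+ 2) ^+ `|z|%N)%:E)); last first.
  by move=> k; rewrite lee_fin !exprn_ge0.
apply: le_trans (nneseries_geometric_le _); last by rewrite x0.
apply: lee_nneseries => [k _ _|k _]; first by rewrite lee_fin !exprn_ge0.
rewrite lee_fin -exprM; apply: ler_wiXn2l => //; first exact: ltW.
by rewrite mulnC muln2 leq_absz_zig.
Qed.

End geometric_sums.

Section annuli.
Context (R : realType) (n : nat) (n0 : (0 < n)%N).
Local Notation V := (lebesgue_rV R n).
Local Notation mu := (leb R n).

Definition dball (k : int) : set V := eball ((2 : R) ^ k).
Definition annulus (k : int) : set V := dball k `\` dball (k - 1).

Lemma exp2z_gt0 (k : int) : (0 < (2 : R) ^ k)%R.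
Proof. exact: exprz_gt0. Qed.

Lemma exp2z_pred (k : int) : ((2 : R) ^ (k - 1) = 2 ^ k / 2)%R.
Proof. by rewrite expfzDr. Qed.

Lemma measurable_dball k : measurable (dball k).
Proof. exact: measurable_eball. Qed.

Lemma measurable_annulus k : measurable (annulus k).
Proof. by apply: measurableD; exact: measurable_dball. Qed.

Lemma annulusP k x : annulus k x <-> ((2 : R) ^ (k - 1) <= enorm x < 2 ^ k)%R.
Proof.
rewrite /annulus /dball /eball /=; split=> [[h1 /negP h2]|/andP[h1 h2]].
  by rewrite h1 leNgt h2.
by split => //; apply/negP; rewrite -leNgt.
Qed.

Lemma dball_le j k : (j <= k)%R -> dball j `<=` dball k.
Proof.
by move=> jk x; rewrite /dball /eball/= => /lt_le_trans; apply; rewrite ler_eXz2l// ltr1n.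
Qed.

Lemma annulus_trivIset : trivIset [set: nat] (annulus \o zig).
Proof.
apply/trivIsetP => i j _ _ ij; apply/disjoints_subset => x /=.
move=> /annulusP/andP[h1 h2] /annulusP/andP[h3 h4].
move/negP: ij; apply; apply/eqP; apply: (bij_inj zig_bij).
have := le_lt_trans h1 h4; have := le_lt_trans h3 h2.
by rewrite !ltr_eXz2l ?ltr1n//; lia.
Qed.

Lemma annulus_cover x : (0 < enorm x)%R -> exists m, annulus (zig m) x.
Proof.
move=> x0; pose y := (ln (enorm x) / ln 2)%R.
have ln2 : (0 < ln (2 : R))%R by rewrite ln_gt0 ?ltr1n.
have [zag _ zagK] := zig_bij; exists (zag (Num.floor y + 1)%R); rewrite zagK.
apply/annulusP; rewrite addrK.
have xE : enorm x = (2 `^ y)%R by rewrite /powR pnatr_eq0/= /y divfK ?gt_eqF// lnK.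
rewrite xE -!powR_intmul//; apply/andP; split.
  by rewrite ler_powR ?ler1n// floor_le_tmp.
rewrite /powR !pnatr_eq0/= ltr_expR ltr_pM2r//.
exact: floorD1_gt.
Qed.

Lemma leb_dball k : mu (dball k) = (((2 : R) ^ k) ^+ n)%:E * mu (eball 1).
Proof. by apply: leb_eball; exact: exp2z_gt0. Qed.

Definition unit_vol : R := fine (mu (eball 1)).

Lemma unit_volE : mu (eball 1) = unit_vol%:E.
Proof. by rewrite fineK// ge0_fin_numE// leb_eball_fin. Qed.

Lemma unit_vol_gt0 : (0 < unit_vol)%R.
Proof. by rewrite -lte_fin -unit_volE leb_eball_gt0. Qed.

(** The inner ball has [2^-n] of the volume of the outer one, at most half of it because [n > 0]. *)
Lemma leb_annulus_ge k : (((2 : R) ^ k) ^+ n * (unit_vol / 2))%:E <= mu (annulus k).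
Proof.
have fin : mu (dball k) < +oo by apply: leb_eball_lty; exact: exp2z_gt0.
have -> : mu (annulus k) = mu (dball k) - mu (dball (k - 1)).
  rewrite /annulus measureD; [|exact: measurable_dball|exact: measurable_dball|exact: fin].
  by rewrite setIidr//; apply: dball_le; rewrite gerBl.
rewrite !leb_dball unit_volE -!EFinM -EFinB lee_fin -mulrBl exp2z_pred.
have e0 := exprn_gt0 n (exp2z_gt0 k); have v0 := unit_vol_gt0.
set e := (_ ^+ n)%R in e0 *.
have -> : (((2 : R) ^ k / 2) ^+ n = e * 2^-1 ^+ n)%R by rewrite exprMn.
have h : ((2^-1 : R) ^+ n <= 2^-1)%R.
  by rewrite -[leRHS]expr1 ler_wiXn2l// ?invr_ge0// invf_le1// ler1n.
have -> : (e * (unit_vol / 2) = e * 2^-1 * unit_vol)%R by ring.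
rewrite ler_pM2r//; have := ler_wpM2l (ltW e0) h.
lra.
Qed.

Lemma measurable_origin : measurable ([set x | enorm x = 0%R] : set V).
Proof.
rewrite (_ : [set x | _] = setT `&` @enorm R n @^-1` [set 0%R]).
  by apply: measurable_enorm.
by rewrite setTI.
Qed.

(** The origin is the one point that no annulus contains. It lies in balls of radius [s <= 1], of
    measure at most [s] times the unit volume. *)
Lemma leb_origin : mu [set x | enorm x = 0%R] = 0.
Proof.
have m0 := measurable_origin.
apply/eqP; rewrite eq_le measure_ge0 andbT.
apply/lee_addgt0Pr => e e0; rewrite add0e.
have v0 := unit_vol_gt0.
pose s : R := Num.min 1%R (e / unit_vol)%R.
have s0 : (0 < s)%R by rewrite lt_min ltr01 divr_gt0.
have s1 : (s <= 1)%R by rewrite ge_min lexx.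
apply: (@le_trans _ _ (mu (eball s))).
  apply: le_measure; rewrite ?inE//; first exact: measurable_eball.
  by move=> x /= x0; rewrite /eball/= x0.
rewrite leb_eball// unit_volE -EFinM lee_fin -ler_pdivlMr//.
apply: (@le_trans _ _ s); last by rewrite ge_min lexx orbT.
by rewrite -[leRHS]expr1 ler_wiXn2l// ltW.
Qed.

Lemma integral_annuli (f : V -> \bar R) : (forall x, 0 <= f x) ->
  measurable_fun [set: V] f ->
  \int[mu]_x f x = \sum_(m <oo) \int[mu]_(x in annulus (zig m)) f x.
Proof.
move=> f0 mf.
have mU : measurable (\bigcup_m (annulus \o zig) m).
  by apply: bigcup_measurable => k _; exact: measurable_annulus.
rewrite -(@ge0_integral_bigcup _ _ _ mu (annulus \o zig) f); first last.
- exact: annulus_trivIset.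
- by move=> x _.
- exact: measurable_funTS.
- by move=> k; exact: measurable_annulus.
rewrite [RHS]integral_mkcond.
apply: ge0_ae_eq_integral => //.
- by apply/(measurable_restrictT _ mU); exact: measurable_funTS.
- by move=> x _; exact: erestrict_ge0.
exists [set x | enorm x = 0%R]; split.
- exact: measurable_origin.
- exact: leb_origin.
move=> x /= h; apply: contrapT => x0; apply: h => _.
have [|m hm] := @annulus_cover x.
  by rewrite lt_neqAle enorm_ge0 andbT eq_sym; apply/eqP.
by rewrite patchE mem_set//; exists m.
Qed.

End annuli.

(** * Young's inequality and reverse doubling *)

Section young.
Context (R : realType).
Implicit Types (p q a b s t : R) (f w x y : \bar R).

Lemma young_real p q s t : (1 <= p)%R -> (1 <= q)%R -> (p^-1 + q^-1 = 1)%R ->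
  (0 <= s)%R -> (0 <= t)%R -> (s * t <= s `^ p + t `^ q)%R.
Proof.
move=> p1 q1 pq s0 t0; have p0 := lt_le_trans ltr01 p1; have q0 := lt_le_trans ltr01 q1.
apply: le_trans (conjugate_powR s0 t0 p0 q0 pq) _; apply: lerD.
  by rewrite ler_pdivrMr// ler_peMr// powR_ge0.
by rewrite ler_pdivrMr// ler_peMr// powR_ge0.
Qed.

(** Young's inequality for [f = a b (f w / a) (w^-1 / b)], to be integrated in place of Hoelder's
    inequality. It holds for all values of the weight: if [f > 0] and [w] is [0] or [+oo], one of
    the two powers is [+oo]. *)
Lemma young_weight p q a b f w : (1 <= p)%R -> (1 <= q)%R -> (p^-1 + q^-1 = 1)%R ->
  (0 < a)%R -> (0 < b)%R -> 0 <= f -> 0 <= w ->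
  f <= (a * b)%:E * ((f * w / a%:E) `^ p + (w^-1 / b%:E) `^ q).
Proof.
move=> p1 q1 pq a0 b0 f0 w0.
have p0 := lt_le_trans ltr01 p1; have q0 := lt_le_trans ltr01 q1.
have ab0 : (0 < a * b)%R by rewrite mulr_gt0.
have rhsy y z : 0 <= y -> 0 <= z -> (y = +oo \/ z = +oo) ->
    (a * b)%:E * (y + z) = +oo.
  by case: y z => [y| |] [z| |]//= _ _ []// _; rewrite gt0_muley ?lte_fin.
rewrite (inve_EFin a0) (inve_EFin b0).
have [->|f_neq0] := eqVneq f 0.
  by rewrite mule_ge0 ?lee_fin ?(ltW ab0)// adde_ge0// poweR_ge0.
have f_gt0 : 0 < f by rewrite lt0e f_neq0.
have [->|w_neq0] := eqVneq w 0.
  rewrite inve0 rhsy ?poweR_ge0 ?leey//; right.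
  by rewrite gt0_mulye ?lte_fin ?invr_gt0// poweRyr// gt_eqF.
have w_gt0 : 0 < w by rewrite lt0e w_neq0.
case: w w0 w_neq0 w_gt0 => [w| |]// w0 _ w_gt0; last first.
  rewrite rhsy ?poweR_ge0 ?leey//; left.
  by rewrite gt0_muley// gt0_mulye ?lte_fin ?invr_gt0// poweRyr// gt_eqF.
case: f f0 f_neq0 f_gt0 => [f| |]// f0 _ f_gt0; last first.
  rewrite rhsy ?poweR_ge0 ?leey//; left.
  by rewrite gt0_mulye// gt0_mulye ?lte_fin ?invr_gt0// poweRyr// gt_eqF.
move: f0 w0 f_gt0 w_gt0; rewrite !lee_fin !lte_fin => f0 w0 f_gt0 w_gt0.
rewrite (inve_EFin w_gt0) -!EFinM lee_fin.
have s0 : (0 <= f * w / a)%R by rewrite divr_ge0 ?mulr_ge0 ?ltW.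
have t0 : (0 <= w^-1 / b)%R by rewrite divr_ge0 ?invr_ge0 ?ltW.
have := young_real p1 q1 pq s0 t0.
have -> : (f * w / a * (w^-1 / b) = f / (a * b))%R by field; rewrite !gt_eqF.
by rewrite (ler_pdivrMr _ _ ab0) [X in (_ <= X)%R -> _]mulrC.
Qed.

(** The form in which log-Hoelder continuity is used, with [z = |k|] and [e] a multiple of the
    difference of two exponents. For [e >= 0] the upper bound on [s] gives [S^M]; for [e < 0] the
    lower bound gives [h^(-z |e|) <= h^(-L)]. *)
Lemma powR_comparable (h S L M s e : R) (z : nat) : (0 < h < 1)%R -> (1 <= S)%R ->
  (h ^+ z <= s <= S)%R -> (`|e| * z%:R <= L)%R -> (`|e| <= M)%R ->
  (s `^ e <= h `^ (- L) * S `^ M)%R.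
Proof.
move=> /andP[h0 h1] S1 /andP[hs sS] eL eM.
have s0 : (0 < s)%R by apply: lt_le_trans hs; rewrite exprn_gt0.
have L0 : (0 <= L)%R by apply: le_trans eL; rewrite mulr_ge0.
have hL : (1 <= h `^ (- L))%R.
  rewrite powRN invf_ge1 ?powR_gt0//.
  by rewrite -(powRr0 h) ger_powR// h0 ltW.
have SM : (1 <= S `^ M)%R.
  by rewrite -(powRr0 S) ler_powR// (le_trans _ eM).
have [e0|e0] := leP 0%R e.
  rewrite (ger0_norm e0) in eM eL.
  apply: (@le_trans _ _ (1 * S `^ M)%R); last by rewrite ler_wpM2r ?powR_ge0.
  rewrite mul1r; apply: (@le_trans _ _ (S `^ e)%R); last by rewrite ler_powR.
  by rewrite ge0_ler_powR// nnegrE ?(ltW s0)// (le_trans _ S1).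
rewrite (ltr0_norm e0) in eM eL.
apply: (@le_trans _ _ (h `^ (- L) * 1)%R); last by rewrite ler_wpM2l ?powR_ge0.
rewrite mulr1 (powRN h L) -[X in (s `^ X)%R]opprK (powRN s (- e)) lef_pV2 ?posrE ?powR_gt0//.
apply: (@le_trans _ _ ((h ^+ z) `^ (- e))%R).
  rewrite -powR_mulrn ?(ltW h0)// -powRrM ger_powR ?h0 ?(ltW h1)//.
  by rewrite mulrC.
by rewrite ge0_ler_powR ?nnegrE ?oppr_ge0 ?(ltW e0) ?(ltW s0) ?exprn_ge0 ?(ltW h0).
Qed.

End young.

Section reverse_doubling.
Context d (T : measurableType d) (R : realType) (m : {measure set T -> \bar R}).
Implicit Types (u h : T -> \bar R) (p q : T -> R).

Lemma measurable_fun_poweRM u p (a : R) : (forall x, 1 <= p x)%R -> (0 < a)%R ->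
  measurable_fun [set: T] p -> (forall x, 0 <= u x) -> measurable_fun [set: T] u ->
  measurable_fun [set: T] (fun x => (u x / a%:E) `^ p x).
Proof.
move=> p1 a0 mp u0 mu; have := @measurable_fun_modular _ T R p u a p1 mp mu a0.
by under eq_fun do rewrite gee0_abs//.
Qed.

Lemma le_integral_subset (A B : set T) (f : T -> \bar R) : measurable A -> measurable B ->
  (forall x, 0 <= f x) -> measurable_fun [set: T] f -> A `<=` B ->
  \int[m]_(x in A) f x <= \int[m]_(x in B) f x.
Proof.
by move=> mA mB f0 mf AB; apply: ge0_subset_integral => //; exact: measurable_funTS.
Qed.

(* [u], [h] stand for a weight and its reciprocal, with norms at most [a], [b] on [B].
   Young's inequality with [s = a / t], [t b], [t = c / 2], integrated over [A], leaves at
   least [t ^ (M + 1)] of the modular of [h / b] on [A], hence less than [1] on [B \ A]. *)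
Lemma reverse_doubling_step p q u h (A B : set T) (M c a b : R) :
  measurable A -> measurable B -> A `<=` B ->
  (forall x, 1 <= p x)%R -> (forall x, 1 <= q x <= M)%R ->
  measurable_fun [set: T] p -> measurable_fun [set: T] q ->
  measurable_fun [set: T] u -> measurable_fun [set: T] h ->
  (forall x, 0 <= u x) -> (forall x, 0 <= h x) ->
  (forall x s t, (0 < s)%R -> (0 < t)%R ->
     1 <= (s * t)%:E * ((u x / s%:E) `^ p x + (h x / t%:E) `^ q x)) ->
  (0 < a)%R -> (0 < b)%R -> (0 < c <= 1)%R -> (c * (a * b))%:E <= m A ->
  \int[m]_(x in A) (u x / a%:E) `^ p x <= 1 ->
  \int[m]_(x in B) (h x / b%:E) `^ q x <= 1 ->
  \int[m]_(x in B `\` A) (h x / ((1 - (c / 2) `^ M * (c / 2)) `^ M^-1 * b)%:E) `^ q x <= 1.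
Proof.
move=> mA mB AB p1 qM mp mq mu mh u0 h0 young a0 b0 /andP[c0 c1] cA uA hB.
have q1 x : (1 <= q x)%R by case/andP: (qM x).
pose t := (c / 2)%R; have t0 : (0 < t)%R by rewrite divr_gt0.
have t1 : (t <= 1)%R by rewrite /t; lra.
have M1 : (1 <= M)%R by have /andP[h1 h2] := qM point; exact: le_trans h2.
have M0 := lt_le_trans ltr01 M1.
set g := fun x => (h x / b%:E) `^ q x in hB.
have g0 x : 0 <= g x by exact: poweR_ge0.
have mg : measurable_fun [set: T] g by exact: measurable_fun_poweRM.
have gA1 : \int[m]_(x in A) g x <= 1.
  by apply: le_trans hB; apply: ge0_subset_integral => //; exact: measurable_funTS.
have gAfin : \int[m]_(x in A) g x \is a fin_num.
  by rewrite ge0_fin_numE ?(le_lt_trans gA1) ?ltry// integral_ge0.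
have tM0 : (0 < t `^ M)%R by rewrite powR_gt0.
have tM1 : (t `^ M <= 1)%R by rewrite -(powRr0 t) ger_powR ?t0 ?t1// ltW.
have key : ((t `^ M * t)%:E <= \int[m]_(x in A) g x).
  have : m A <= (a * b)%:E * (t%:E + ((t `^ M)^-1)%:E * \int[m]_(x in A) g x).
    have -> : m A = \int[m]_(x in A) (cst 1) x by rewrite integral_cst// mul1e.
    have mtg : measurable_fun A (fun x => ((t `^ M)^-1)%:E * g x).
      by apply: measurable_funeM; exact: measurable_funTS.
    have mtu : measurable_fun A (fun x => t%:E * (u x / a%:E) `^ p x).
      by apply: measurable_funeM; apply: measurable_funTS; exact: measurable_fun_poweRM.
    apply: (@le_trans _ _ (\int[m]_(x in A) ((a * b)%:E *
        (t%:E * (u x / a%:E) `^ p x + ((t `^ M)^-1)%:E * g x)))).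
      apply: ge0_le_integral => //.
        by apply: measurable_funeM; exact: emeasurable_funD.
      move=> x Ax; have := young x (a / t)%R (t * b)%R.
      have -> : (a / t * (t * b) = a * b)%R by field; rewrite gt_eqF.
      move=> /(_ _ _)/le_trans; apply; rewrite ?divr_gt0 ?mulr_gt0//.
      apply: lee_wpmul2l; first by rewrite lee_fin mulr_ge0// ltW.
      apply: leeD.
        apply: le_trans (poweR_scale_le1 _ (p1 x) _); last 2 first.
        - by rewrite t1 ltW.
        - by rewrite mule_ge0// inve_ge0 lee_fin ltW.
        rewrite !inve_EFin ?divr_gt0// muleCA -EFinM.
        by rewrite invf_div.
      have -> : ((t `^ M)^-1 = t^-1 `^ M)%R by rewrite -(powR_inv1 (ltW t0)) -powRrM mulN1r powRN.
      apply: le_trans (poweR_scale_ge1 _ (_ : q x <= M)%R _); last 3 first.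
      - by rewrite invf_ge1.
      - by case/andP: (qM x).
      - by rewrite mule_ge0// inve_ge0 lee_fin ltW.
      rewrite !inve_EFin ?mulr_gt0// muleCA -EFinM invfM.
      by [].
    rewrite ge0_integralZl_EFin//; last 3 first.
    - by move=> x _; rewrite adde_ge0// mule_ge0// ?poweR_ge0// lee_fin ?invr_ge0 ltW.
    - exact: emeasurable_funD.
    - by rewrite mulr_ge0 ?ltW.
    apply: lee_wpmul2l; first by rewrite lee_fin mulr_ge0 ?ltW.
    rewrite ge0_integralD//; last 2 first.
    - by move=> x _; rewrite mule_ge0 ?poweR_ge0// lee_fin ltW.
    - by move=> x _; rewrite mule_ge0// lee_fin invr_ge0 ltW.
    apply: leeD.
      rewrite ge0_integralZl_EFin ?(ltW t0)//.
      - by rewrite -[leRHS]mule1 lee_wpmul2l// lee_fin ltW.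
      - by move=> x _; exact: poweR_ge0.
      - by apply: measurable_funTS; exact: measurable_fun_poweRM.
    rewrite ge0_integralZl_EFin ?invr_ge0 ?(ltW tM0)//.
    exact: measurable_funTS.
  move=> /(le_trans cA); rewrite -(fineK gAfin) -!EFinM !lee_fin.
  rewrite (mulrC c) ler_pM2l ?mulr_gt0//.
  rewrite -lerBlDl (_ : (c - t = t)%R); last by rewrite /t; lra.
  by rewrite ler_pdivlMl.
(* [th^M] bounds the modular left on [B \ A]; as [th <= 1] and [q <= M], replacing the level [b] by
   [th b] multiplies the integrand by at most [th^(-M)]. *)
set th := ((1 - t `^ M * t) `^ M^-1)%R.
have k1 : (0 < 1 - t `^ M * t)%R.
  have : (t `^ M * t <= 1 * t)%R by rewrite ler_wpM2r// ltW.
  by rewrite /t; lra.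
have th0 : (0 < th)%R by rewrite powR_gt0.
have thM : (th `^ M = 1 - t `^ M * t)%R by rewrite /th -powRrM mulVf ?gt_eqF// powRr1// ltW.
have th1 : (th <= 1)%R.
  have <- : (1 `^ M^-1 = 1 :> R)%R by rewrite powR1.
  rewrite ge0_ler_powR ?nnegrE ?invr_ge0 ?(ltW M0) ?(ltW k1)//.
  by rewrite gerBl mulr_ge0 ?ltW.
have gBA : \int[m]_(x in B `\` A) g x <= (1 - t `^ M * t)%:E.
  have mBA : measurable (B `\` A) by exact: measurableD.
  have AB0 : [disjoint A & B `\` A] by apply/disj_setPS => x [Ax []].
  have := @ge0_integral_setU _ _ _ m A (B `\` A) mA mBA g (measurable_funTS mg)
    (fun x _ => g0 x) AB0.
  rewrite setDUK// => gE; move: hB; rewrite gE => hB.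
  rewrite EFinB leeBrDr//; apply: le_trans hB; rewrite addeC.
  exact: leeD.
apply: (@le_trans _ _ (\int[m]_(x in B `\` A) ((th^-1 `^ M)%:E * g x))).
  apply: ge0_le_integral.
  - exact: measurableD.
  - by move=> x _; exact: poweR_ge0.
  - by apply: measurable_funTS; apply: measurable_fun_poweRM => //; rewrite mulr_gt0.
  - by apply: measurable_funeM; exact: measurable_funTS.
  move=> x _; apply: le_trans (poweR_scale_ge1 _ (_ : q x <= M)%R _); last 3 first.
  - by rewrite invf_ge1.
  - by case/andP: (qM x).
  - by rewrite mule_ge0// inve_ge0 lee_fin ltW.
  by rewrite !inve_EFin ?mulr_gt0// muleCA -EFinM invfM.
rewrite ge0_integralZl_EFin ?powR_ge0//; last 2 first.
- exact: measurableD.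
- exact: measurable_funTS.
have -> : (th^-1 `^ M = (1 - t `^ M * t)^-1)%R.
  by rewrite -thM -(powR_inv1 (ltW th0)) -powRrM mulN1r powRN.
by rewrite muleC lee_pdivrMr// mul1e.
Qed.

End reverse_doubling.

Lemma geometric_growth (R : realType) (W : int -> R) (th : R) :
  (0 < th)%R -> (forall k, 0 < W k)%R ->
  (forall k, W (k - 1)%R <= th * W k)%R ->
  forall j k : int, (j <= k)%R -> (W j <= th ^+ `|(k - j)%R|%N * W k)%R.
Proof.
move=> th0 W0 Wth j k jk.
have -> : j = (k - (`|(k - j)%R|%N)%:Z)%R by lia.
move: (`|(k - j)%R|%N) => m; have -> : (`|(k - (k - m%:Z))%R|%N = m) by lia.
elim: m => [|m IH]; first by rewrite subr0 expr0 mul1r.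
have -> : (k - m.+1%:Z = (k - m%:Z) - 1)%R by lia.
apply: le_trans (Wth _) _; rewrite exprS -mulrA ler_wpM2l//; exact: ltW.
Qed.

(** * Norms of the weight and its reciprocal over dyadic balls *)

Section ball_norms.
Context (R : realType) (n : nat) (n0 : (0 < n)%N).
Local Notation V := (lebesgue_rV R n).
Local Notation mu := (leb R n).
Implicit Types (u w : V -> \bar R) (p r : V -> R).

Lemma modular_indic r u (A : set V) (l : R) : (0 < l)%R -> (forall x, 0 < r x)%R ->
  (forall x, 0 <= u x) ->
  modular r (fun x => u x * (\1_A x)%:E) l = \int[mu]_(x in A) (u x / l%:E) `^ r x.
Proof.
move=> l0 r0 u0; rewrite [RHS]integral_mkcond; apply: eq_integral => x _.
rewrite patchE indicE; case: ifPn => _; first by rewrite mule1 gee0_abs.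
by rewrite mule0 abse0 mul0e poweR0r// gt_eqF.
Qed.

Lemma leb_dball_gt0 k : 0 < mu (dball k : set V).
Proof.
rewrite leb_dball mule_gt0 ?lte_fin ?exprn_gt0 ?exp2z_gt0//.
exact: leb_eball_gt0.
Qed.

(** A zero norm would make [u] vanish almost everywhere on a ball of positive measure. *)
Lemma vnorm_dball_neq0 r u k : (forall x, 1 <= r x)%R -> measurable_fun [set: V] r ->
  measurable_fun [set: V] u -> {ae mu, forall x, 0 < u x} ->
  vnorm r (fun x => u x * (\1_(dball k) x)%:E) != 0.
Proof.
move=> r1 mr mu_ u0; apply/negP => /eqP /vnorm_eq0 h.
have mI : measurable_fun [set: V] (fun x => u x * (\1_(dball k) x)%:E).
  apply: emeasurable_funM; first exact: mu_.
  by apply/measurable_EFinP; apply: measurable_indic; exact: measurable_dball.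
have [N [mN N0 hN]] : {ae mu, forall x, ~ dball k x}.
  move: u0 (h r1 mr mI); apply: filterS2 => x ux + Bx.
  by rewrite indicE mem_set// mule1 => ux0; move: ux; rewrite ux0 ltxx.
have := leb_dball_gt0 k; apply/negP; rewrite -leNgt -[leRHS]N0.
apply: le_measure; rewrite ?inE//; first exact: measurable_dball.
by move=> x Bx; apply: hN => /=; exact.
Qed.

(* [W k] and [S k] are the norms of [w] and [w^-1] on the ball of radius [2^k]. *)
Lemma Ap0_ball_norms p w (a M : R) : measurable_fun [set: V] p -> (1 < a)%R ->
  (forall x, a <= p x <= M)%R -> weight w -> A_p0 p w ->
  exists C (W S : int -> R), (0 < C)%R /\ forall k,
  [/\ (0 < W k)%R, (0 < S k)%R, (W k * S k <= C * ((2 : R) ^ k) ^+ n)%R,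
    \int[mu]_(x in dball k) (w x / (W k)%:E) `^ p x <= 1 /\
    (forall l, (0 < l)%R -> \int[mu]_(x in dball k) (w x / l%:E) `^ p x <= 1 ->
       (W k <= l)%R) &
    \int[mu]_(x in dball k) ((w x)^-1 / (S k)%:E) `^ conj_exponent p x <= 1 /\
    (forall l, (0 < l)%R ->
       \int[mu]_(x in dball k) ((w x)^-1 / l%:E) `^ conj_exponent p x <= 1 ->
       (S k <= l)%R)].
Proof.
move=> mp a1 pa [mw w0 _ aew] [C [C0 hC]].
have p1 x : (1 < p x)%R by have /andP[h _] := pa x; exact: lt_le_trans h.
have p0 x : (0 < p x)%R by exact: lt_trans (p1 x).
have p1' x : (1 <= p x)%R by exact: ltW.
have q1 x : (1 <= conj_exponent p x)%R by have /andP[] := conj_exponent_bounds a1 pa x.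
have q0 x : (0 < conj_exponent p x)%R by exact: lt_le_trans (q1 x).
have mq : measurable_fun [set: V] (conj_exponent p) by exact: measurable_conj_exponent.
have mv : measurable_fun [set: V] (fun x => (w x)^-1) by exact: measurable_fun_inve.
have v0 x : 0 <= (w x)^-1 by rewrite inve_ge0.
pose J k := vnorm p (fun x => w x * (\1_(dball k) x)%:E).
pose I k := vnorm (conj_exponent p) (fun x => (w x)^-1 * (\1_(dball k) x)%:E).
have JI k : J k * I k <= (C * ((2 : R) ^ k) ^+ n)%:E by apply: hC; exact: exp2z_gt0.
have J_neq0 k : J k != 0.
  by apply: vnorm_dball_neq0 => //; apply: filterS aew => x /andP[].
have I_neq0 k : I k != 0.
  apply: vnorm_dball_neq0 => //; apply: filterS aew => x /andP[wx0 wxy].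
  by rewrite inve_gt0 ?wx0// ?(gt_eqF wx0)// (lt_eqF wxy).
have J0 k : 0 < J k by rewrite lt0e J_neq0 vnorm_ge0.
have I0 k : 0 < I k by rewrite lt0e I_neq0 vnorm_ge0.
(* The product [J k * I k] is finite and both factors are positive, so each is finite. *)
have JE k : J k = (fine (J k))%:E.
  rewrite fineK// ge0_fin_numE ?ltW// ltey; apply/negP => /eqP Jy.
  by have := JI k; rewrite Jy gt0_mulye.
have IE k : I k = (fine (I k))%:E.
  rewrite fineK// ge0_fin_numE ?ltW// ltey; apply/negP => /eqP Iy.
  by have := JI k; rewrite Iy gt0_muley.
have mball (u : V -> \bar R) k : measurable_fun [set: V] u ->
    measurable_fun [set: V] (fun x => u x * (\1_(dball k) x)%:E).
  move=> mu_; apply: emeasurable_funM; first exact: mu_.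
  by apply/measurable_EFinP; apply: measurable_indic; exact: measurable_dball.
exists C, (fun k => fine (J k)), (fun k => fine (I k)); split=> // k.
have W0 : (0 < fine (J k))%R by rewrite -lte_fin -JE.
have S0 : (0 < fine (I k))%R by rewrite -lte_fin -IE.
have bp x : (1 <= p x <= M)%R by have /andP[_ ->] := pa x; rewrite p1'.
split => //.
- by rewrite -lee_fin EFinM -JE -IE.
- split.
    rewrite -(modular_indic _ W0 p0 w0); apply: (vnorm_attained bp mp (mball w k mw) W0).
    by rewrite -JE.
  move=> l l0; rewrite -(modular_indic _ l0 p0 w0) => /(vnorm_le l0).
  by rewrite -/(J k) JE lee_fin.
- split.
    rewrite -(modular_indic _ S0 q0 v0).
    apply: (vnorm_attained (conj_exponent_bounds a1 pa) mq (mball _ k mv) S0).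
    by rewrite -IE.
  move=> l l0; rewrite -(modular_indic _ l0 q0 v0) => /(vnorm_le l0).
  by rewrite -/(I k) IE lee_fin.
Qed.

Lemma dball_setD_annulus k : dball k `\` annulus k = dball (k - 1) :> set V.
Proof.
rewrite /annulus setDD setIidr//; apply: dball_le; rewrite gerBl//.
Qed.

(** [reverse_doubling_step] on the annulus inside its ball makes the shrunken level admissible on
    [dball (k - 1)], and the norm there is the least admissible level. The pair [u], [h] is later
    both [w], [w^-1] and [w^-1], [w]. *)
Lemma ball_norm_growth p q (u h : V -> \bar R) (W S : int -> R) (M c : R) k :
  (forall x, 1 <= p x)%R -> (forall x, 1 <= q x <= M)%R ->
  measurable_fun [set: V] p -> measurable_fun [set: V] q ->
  measurable_fun [set: V] u -> measurable_fun [set: V] h ->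
  (forall x, 0 <= u x) -> (forall x, 0 <= h x) ->
  (forall x s t, (0 < s)%R -> (0 < t)%R ->
     1 <= (s * t)%:E * ((u x / s%:E) `^ p x + (h x / t%:E) `^ q x)) ->
  (0 < W k)%R -> (0 < S k)%R -> (0 < c <= 1)%R ->
  (c * (W k * S k) <= ((2 : R) ^ k) ^+ n * (unit_vol R n / 2))%R ->
  \int[mu]_(x in dball k) (u x / (W k)%:E) `^ p x <= 1 ->
  \int[mu]_(x in dball k) (h x / (S k)%:E) `^ q x <= 1 ->
  (forall l, (0 < l)%R -> \int[mu]_(x in dball (k - 1)) (h x / l%:E) `^ q x <= 1 ->
     (S (k - 1) <= l)%R) ->
  (S (k - 1)%R <= (1 - (c / 2) `^ M * (c / 2)) `^ M^-1 * S k)%R.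
Proof.
move=> p1 qM mp mq mu_ mh u0 h0 young W0 S0 c01 cv uW hS min.
have mA := @measurable_annulus R n k; have mB := @measurable_dball R n k.
have AB : (annulus k : set V) `<=` dball k by apply: subDsetl.
have /andP[c0 c1] := c01.
have M1 : (1 <= M)%R by have /andP[h1 h2] := qM point; exact: le_trans h2.
have t0 : (0 < c / 2)%R by rewrite divr_gt0.
have t1 : ((c / 2) `^ M <= 1)%R.
  by rewrite -[leRHS](powRr0 (c / 2)%R) ger_powR ?(le_trans ler01)// t0/=; lra.
have th0 : (0 < (1 - (c / 2) `^ M * (c / 2)) `^ M^-1)%R.
  apply: powR_gt0; have : ((c / 2) `^ M * (c / 2) <= 1 * (c / 2))%R.
    by rewrite ler_wpM2r// ltW.
  lra.
apply: min; first exact: mulr_gt0.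
rewrite -dball_setD_annulus.
apply: (reverse_doubling_step mA mB AB p1 qM mp mq mu_ mh u0 h0 young W0 S0 c01 _ _ hS).
  by apply: le_trans (leb_annulus_ge _ _ _) => //; rewrite lee_fin.
apply: le_trans uW; have mg := measurable_fun_poweRM p1 W0 mp u0 mu_.
exact: (le_integral_subset _ mA mB (fun x => poweR_ge0 _ _) mg AB).
Qed.

End ball_norms.

(** * Log-Hoelder continuity on the annuli *)

Section log_hoelder.
Context (R : realType) (n : nat).
Local Notation V := (lebesgue_rV R n).
Implicit Types (p : V -> R).

Definition sgn_exponent (p0 poo : R) (z : int) : R := if (z < 0)%R then p0 else poo.

(** On [annulus z] the quantity [- ln |x|] (for [z < 0]) is at least [|z| ln 2], and [ln (e + |x|)]
    (for [z >= 0]) is at least [|z| ln 2 / 2]; hence the two constants in the maximum. *)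
Lemma log_hoelder_annuli p : LH0 p -> LHoo p ->
  exists p0 poo L : R, [/\ (1 <= p0)%R, (1 <= poo)%R &
    forall z x, annulus z x -> (`|p x - sgn_exponent p0 poo z| * (`|z|%N)%:R <= L)%R].
Proof.
move=> [C0 [p0 [C00 p01 h0]]] [Coo [poo [Coo0 poo1 hoo]]].
have ln2 : (0 < ln (2 : R))%R by rewrite ln_gt0 ?ltr1n.
have pow2 (z : int) : ((2 : R) ^ z = expR (z%:~R * ln 2))%R.
  by rewrite -powR_intmul// /powR pnatr_eq0.
exists p0, poo, (Num.max (C0 / ln 2) (2 * Coo / ln 2))%R; split=> // z x /annulusP/andP[x1 x2].
have x0 : (0 < enorm x)%R by apply: lt_le_trans x1; exact: exp2z_gt0.
rewrite le_max /sgn_exponent; case: ltP => z0; apply/orP; [left|right].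
  have zE : ((`|z|%N)%:R = - z%:~R :> R)%R.
    by rewrite pmulrn -mulrNz; congr (_%:~R); lia.
  have lnx : (ln (enorm x) < z%:~R * ln 2)%R.
    by rewrite -[ltRHS]expRK -pow2 ltr_ln ?posrE// exp2z_gt0.
  have zR : (0 < (`|z|%N)%:R :> R)%R by rewrite ltr0n absz_gt0; lia.
  have xhalf : (enorm x < 2^-1)%R.
    apply: (lt_le_trans x2); rewrite -(exprN1 (2 : R)) ler_eXz2l ?ltr1n//; lia.
  have := h0 x; rewrite x0 xhalf => /(_ isT) hx.
  apply: (@le_trans _ _ (C0 / - ln (enorm x) * (`|z|%N)%:R)%R).
    by rewrite ler_wpM2r.
  have lnx' : ((`|z|%N)%:R * ln 2 <= - ln (enorm x))%R by rewrite zE; lra.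
  have lnx0 : (0 < - ln (enorm x))%R by apply: lt_le_trans lnx'; rewrite mulr_gt0.
  rewrite mulrAC ler_pdivrMr// -!mulrA ler_pM2l// mulrC -ler_pdivrMr ?invr_gt0// invrK.
  exact: lnx'.
have zE : ((`|z|%N)%:R = z%:~R :> R)%R by rewrite pmulrn; congr (_%:~R); lia.
have e2 : (2 <= expR (1 : R))%R by have := expR_ge1Dx (1 : R); lra.
have lnx : ((`|z|%N)%:R * ln 2 / 2 <= ln (expR 1 + enorm x))%R.
  (* From [|x| >= 2^(z - 1)] one gets [z - 1 >= z / 2] only for [z >= 2]; for [z = 0, 1] the summand
     [e] alone suffices. *)
  have [z1|z1] := leP z 1%R.
    have hz : ((`|z|%N)%:R <= 1 :> R)%R by rewrite lern1; lia.
    apply: (@le_trans _ _ (ln (2 : R))).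
      have := ler_wpM2r (ltW ln2) hz; have : (0 <= (`|z|%N)%:R :> R)%R by [].
      lra.
    by rewrite ler_ln ?posrE//; lra.
  apply: (@le_trans _ _ ((z - 1)%:~R * ln 2)%R).
    rewrite zE intrD mulrNz rmorph1.
    have : (2%:~R <= z%:~R :> R)%R by rewrite ler_int; lia.
    rewrite -[2%:~R]/(2 : R)%R => hz.
    have := ler_wpM2r (ltW ln2) hz; lra.
  rewrite -[leLHS]expRK -pow2 ler_ln ?posrE ?exp2z_gt0//; last by lra.
  by apply: (le_trans x1); lra.
have l0 : (0 < ln (expR 1 + enorm x))%R by rewrite ln_gt0//; lra.
apply: (@le_trans _ _ (Coo / ln (expR 1 + enorm x) * (`|z|%N)%:R)%R).
  by rewrite ler_wpM2r.
rewrite mulrAC ler_pdivrMr// (mulrC 2%R) -!mulrA ler_pM2l//.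
rewrite mulrA mulrC -ler_pdivrMr ?divr_gt0// invf_div mulrA.
exact: lnx.
Qed.

End log_hoelder.

(** * Convolution with a geometric kernel *)

Section discrete_convolution.
Context (R : realType) (x : R) (x01 : (0 < x < 1)%R).
Local Notation h := (x ^+ 2)%R.
Local Notation Th := ((1 - x)^-1)%R.
Implicit Types (a q : nat -> R).

Lemma zdistC k j : zdist k j = zdist j k.
Proof. by rewrite /zdist; lia. Qed.

Lemma nneseries_term (u : nat -> \bar R) k : (forall j, 0 <= u j) ->
  u k <= \sum_(j <oo) u j.
Proof.
move=> u0; apply: le_trans (nneseries_lim_ge k.+1 (fun j _ _ => u0 j)).
by rewrite big_nat_recr//= leeDr// sume_ge0.
Qed.

Lemma nneseries_zdist k : \sum_(j <oo) (h ^+ zdist k j)%:E <= Th%:E.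
Proof.
have [/ltW x0 x1] := andP x01.
under eq_eseriesr do rewrite zdistC.
by apply: nneseries_absz_zig; rewrite x0 x1.
Qed.

Lemma inv1B_ge1 : (1 <= Th)%R.
Proof. by have [x0 x1] := andP x01; rewrite invf_ge1; lra. Qed.

Lemma sqr_in01 : (0 < h < 1)%R.
Proof. by have [x0 x1] := andP x01; rewrite exprn_gt0// exprn_ilt1// ltW. Qed.

Definition conv a k : \bar R := \sum_(j <oo) (h ^+ zdist k j * a j)%:E.

Let conv_term_ge0 a k j : (forall j, 0 <= a j)%R -> 0 <= (h ^+ zdist k j * a j)%:E.
Proof.
by move=> a0; have /andP[h0 _] := sqr_in01; rewrite lee_fin mulr_ge0// exprn_ge0// ltW.
Qed.

Lemma conv_le a k (b : R) : (forall j, 0 <= a j <= b)%R -> conv a k <= (b * Th)%:E.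
Proof.
move=> ab; have /andP[h0 _] := sqr_in01.
have b0 : (0 <= b)%R by have /andP[h1 h2] := ab 0%N; exact: le_trans h2.
apply: (@le_trans _ _ (\sum_(j <oo) (b%:E * (h ^+ zdist k j)%:E))).
  apply: lee_nneseries => [j _ _|j _].
    by apply: conv_term_ge0 => i; case/andP: (ab i).
  have hj : (0 <= h ^+ zdist k j)%R by rewrite exprn_ge0// ltW.
  by rewrite -EFinM lee_fin mulrC ler_wpM2r//; case/andP: (ab j).
rewrite nneseriesZl; last by move=> j _; rewrite lee_fin exprn_ge0// ltW.
by rewrite EFinM lee_wpmul2l// nneseries_zdist.
Qed.

Lemma nneseries_conv_le a : (forall j, 0 <= a j)%R ->
  \sum_(k <oo) conv a k <= Th%:E * \sum_(j <oo) (a j)%:E.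
Proof.
move=> a0; have /andP[h0 _] := sqr_in01; have Th1 := inv1B_ge1.
rewrite /conv nneseries_interchange; last by move=> *; exact: conv_term_ge0.
rewrite -nneseriesZl; last by move=> j _; rewrite lee_fin.
apply: lee_nneseries => [j _ _|j _].
  by apply: nneseries_ge0 => k _ _; exact: conv_term_ge0.
under eq_eseriesr do rewrite mulrC EFinM zdistC.
rewrite nneseriesZl; last by move=> k _; rewrite lee_fin exprn_ge0// ltW.
by rewrite muleC lee_wpmul2r ?lee_fin// nneseries_zdist.
Qed.

Lemma le_powR_inv (s q : R) : (0 < s <= 1)%R -> (1 <= q)%R -> (s <= s `^ q^-1)%R.
Proof. by move=> s01 q1; apply: ger1_powR => //; rewrite invf_le1// (lt_le_trans ltr01). Qed.

(* Bounding one term at a time replaces Jensen's inequality; the extra factor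
   [h ^ zdist k j] is what makes the bound summable in [j]. *)
Lemma conv_powR_term a (p0 poo : R) k j (M : R) : (1 <= p0)%R -> (1 <= poo)%R ->
  let q i := sgn_exponent p0 poo (zig i) in
  (forall i, h ^+ `|zig i|%N <= a i <= 2)%R -> conv a k = M%:E ->
  (h ^+ zdist k j * a j `^ (q j)^-1 <= 2 * M `^ (q k)^-1)%R.
Proof.
move=> p01 poo1 q ab aM; have /andP[h0 h1] := sqr_in01.
have q1 i : (1 <= q i)%R by rewrite /q /sgn_exponent; case: ifP.
have q0 i : (0 < q i)%R by exact: lt_le_trans (q1 i).
have a0 i : (0 < a i)%R by have /andP[+ _] := ab i; apply: lt_le_trans; rewrite exprn_gt0.
have hM i : (h ^+ zdist k i * a i <= M)%R.
  rewrite -lee_fin -aM; apply: (@nneseries_term (fun i => (h ^+ zdist k i * a i)%:E) i).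
  by move=> ?; apply: conv_term_ge0 => ?; exact: ltW.
have M0 : (0 < M)%R by apply: lt_le_trans (hM 0%N); rewrite mulr_gt0// exprn_gt0.
have hpow m : (0 < h ^+ m <= 1)%R by rewrite exprn_gt0// exprn_ile1// ltW.
have hk m : (0 <= h ^+ m)%R by case/andP: (hpow m) => /ltW.
have mono s r : (0 <= s)%R -> (s <= M)%R -> (0 < r)%R -> (s `^ r^-1 <= M `^ r^-1)%R.
  by move=> s0 sM r0; rewrite ge0_ler_powR ?nnegrE ?invr_ge0 ?(ltW r0) ?(ltW M0).
have MM r : (M `^ r^-1 <= 2 * M `^ r^-1)%R by rewrite ler_peMl ?powR_ge0//; lra.
have [same|diff] := boolP ((zig k < 0)%R == (zig j < 0)%R).
  have <- : q k = q j by rewrite /q /sgn_exponent (eqP same).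
  apply: le_trans (MM _); apply: le_trans (mono _ _ _ (hM j) (q0 k)); last first.
    by rewrite mulr_ge0// ltW.
  rewrite (powRM _ (hk _) (ltW (a0 j))).
  by rewrite ler_wpM2r ?powR_ge0// le_powR_inv.
(* For indices of different sign [a j] is not compared with [M] at all: the distance is at least
   [|zig k|], so the kernel is at most [h^|zig k| <= a k <= M], and the power of [a j] is at most
   [2]. *)
have zd : (`|zig k|%N <= zdist k j)%N by move: diff; rewrite /zdist; lia.
have aj2 : (a j `^ (q j)^-1 <= 2)%R.
  have /andP[_ aj] := ab j.
  apply: (@le_trans _ _ (2 `^ (q j)^-1)%R).
    by rewrite ge0_ler_powR ?nnegrE ?invr_ge0 ?(ltW (q0 j)) ?(ltW (a0 j)).
  by apply: ler1_powR; rewrite ?ler1n// invf_le1.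
rewrite mulrC; apply: ler_pM; rewrite ?powR_ge0//.
apply: (@le_trans _ _ (h ^+ `|zig k|%N)%R); first by rewrite ler_wiXn2l// ltW.
apply: (le_trans (le_powR_inv (hpow _) (q1 k))).
apply: mono => //.
apply: le_trans (hM k); rewrite /zdist subrr expr0 mul1r.
by case/andP: (ab k).
Qed.

(** Exchanges the exponents [q j] for [q k]. The kernel has ratio [h^2]: one factor is consumed by
    [conv_powR_term], the other is summed to at most [Th]. *)
Lemma nneseries_conv_powR a (p0 poo : R) k (M : R) : (1 <= p0)%R -> (1 <= poo)%R ->
  let q i := sgn_exponent p0 poo (zig i) in
  (forall i, h ^+ `|zig i|%N <= a i <= 2)%R -> conv a k = M%:E ->
  \sum_(j <oo) ((h ^+ 2) ^+ zdist k j * a j `^ (q j)^-1)%:E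
    <= (2 * Th * M `^ (q k)^-1)%:E.
Proof.
move=> p01 poo1 q ab aM; have /andP[h0 h1] := sqr_in01.
apply: (@le_trans _ _ (\sum_(j <oo) (2 * M `^ (q k)^-1)%:E * (h ^+ zdist k j)%:E)).
  apply: lee_nneseries => [j _ _|j _].
    by rewrite lee_fin mulr_ge0 ?powR_ge0// exprn_ge0// exprn_ge0// ltW.
  rewrite -EFinM lee_fin exprAC expr2 -mulrA [leRHS]mulrC.
  have hj : (0 <= h ^+ zdist k j)%R by rewrite exprn_ge0// ltW.
  by rewrite ler_wpM2l// (conv_powR_term _ p01 poo1 ab aM).
rewrite nneseriesZl; last by move=> j _; rewrite lee_fin exprn_ge0// ltW.
have -> : (2 * Th * M `^ (q k)^-1 = (2 * M `^ (q k)^-1) * Th)%R by ring.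
by rewrite [leRHS]EFinM lee_wpmul2l ?nneseries_zdist// lee_fin mulr_ge0 ?powR_ge0.
Qed.

End discrete_convolution.

Section set_integrals.
Context d (T : measurableType d) (R : realType) (m : {measure set T -> \bar R}).

Lemma integral_set_scale_le (A : set T) (f g : T -> \bar R) (c : R) :
  measurable A -> (0 <= c)%R -> (forall x, 0 <= f x) -> (forall x, 0 <= g x) ->
  measurable_fun [set: T] f -> measurable_fun [set: T] g ->
  (forall x, A x -> g x <= c%:E * f x) ->
  \int[m]_(x in A) g x <= c%:E * \int[m]_(x in A) f x.
Proof.
move=> mA c0 f0 g0 mf mg gf; rewrite -ge0_integralZl_EFin//; last exact: measurable_funTS.
apply: ge0_le_integral => //; first exact: measurable_funTS.
by apply: measurable_funeM; exact: measurable_funTS.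
Qed.

Lemma integral_set_le_add (A : set T) (f g1 g2 : T -> \bar R) (c : R) :
  measurable A -> (0 <= c)%R -> (forall x, 0 <= f x) ->
  (forall x, 0 <= g1 x) -> (forall x, 0 <= g2 x) ->
  measurable_fun [set: T] f -> measurable_fun [set: T] g1 -> measurable_fun [set: T] g2 ->
  (forall x, f x <= c%:E * (g1 x + g2 x)) ->
  \int[m]_(x in A) g1 x <= 1 -> \int[m]_(x in A) g2 x <= 1 ->
  \int[m]_(x in A) f x <= (2 * c)%:E.
Proof.
move=> mA c0 f0 g10 g20 mf mg1 mg2 fg h1 h2.
apply: (@le_trans _ _ (c%:E * \int[m]_(x in A) (g1 x + g2 x))).
  apply: integral_set_scale_le => //.
  - by move=> x; rewrite adde_ge0.
  - exact: emeasurable_funD.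
rewrite mulrC EFinM lee_wpmul2l ?lee_fin// ge0_integralD//; last 2 first.
- exact: measurable_funTS.
- exact: measurable_funTS.
by apply: le_trans (leeD h1 h2) _; rewrite -EFinD lee_fin.
Qed.

End set_integrals.

(** * The implication (iii) => (ii) *)

Section sufficiency.
Context (R : realType) (n : nat) (n0 : (0 < n)%N).
Local Notation V := (lebesgue_rV R n).
Local Notation mu := (leb R n).
Implicit Types (f w : V -> \bar R) (p : V -> R).

Lemma conj_exponentK p x : (1 < p x)%R -> ((p x)^-1 + (conj_exponent p x)^-1 = 1)%R.
Proof. by move=> p1; rewrite /conj_exponent invrK; ring. Qed.

(** The norm over the smaller of the two balls is carried to the larger ball by geometric growth,
    and there [A_p0] bounds the product. *)
Lemma Ap0_kernel_bound p w (a M : R) : measurable_fun [set: V] p -> (1 < a)%R ->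
  (forall x, a <= p x <= M)%R -> weight w -> A_p0 p w ->
  exists (C th : R) (W S : int -> R), [/\ (0 < C)%R, (0 < th < 1)%R,
    forall k, [/\ (0 < W k)%R, (0 < S k)%R,
      \int[mu]_(x in dball k) (w x / (W k)%:E) `^ p x <= 1 &
      \int[mu]_(x in dball k) ((w x)^-1 / (S k)%:E) `^ conj_exponent p x <= 1] &
    forall j k, (W k * S j <= C * th ^+ `|(k - j)%R|%N * ((2 : R) ^ Num.max j k) ^+ n)%R].
Proof.
move=> mp a1 pa ww Aw; have [C [W [S [C0 WS]]]] := Ap0_ball_norms mp a1 pa ww Aw.
have [mw w0 _ _] := ww.
have p1 x : (1 < p x)%R by have /andP[h _] := pa x; exact: lt_le_trans h.
have q1 x : (1 <= conj_exponent p x)%R by have /andP[] := conj_exponent_bounds a1 pa x.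
have mq : measurable_fun [set: V] (conj_exponent p) by exact: measurable_conj_exponent.
have mv : measurable_fun [set: V] (fun x => (w x)^-1) by exact: measurable_fun_inve.
have v0 x : 0 <= (w x)^-1 by rewrite inve_ge0.
have W0 k : (0 < W k)%R by case: (WS k).
have S0 k : (0 < S k)%R by case: (WS k).
have WSC k : (W k * S k <= C * ((2 : R) ^ k) ^+ n)%R by case: (WS k).
have Wm k : \int[mu]_(x in dball k) (w x / (W k)%:E) `^ p x <= 1 by case: (WS k) => _ _ _ [].
have Sm k : \int[mu]_(x in dball k) ((w x)^-1 / (S k)%:E) `^ conj_exponent p x <= 1.
  by case: (WS k) => _ _ _ _ [].
(* A common bound for [p] and its conjugate gives one ratio [th] for both norms. *)
pose N := Num.max M ((1 - a^-1)^-1)%R.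
have pN x : (1 <= p x <= N)%R.
  by have /andP[_ h] := pa x; rewrite (ltW (p1 x)) le_max h.
have qN x : (1 <= conj_exponent p x <= N)%R.
  by have /andP[-> h] := conj_exponent_bounds a1 pa x; rewrite le_max h orbT.
have vol0 := @unit_vol_gt0 R n.
(* Chosen so that [c W_k S_k] is at most the lower bound for the volume of the annulus in
   [leb_annulus_ge]. *)
pose c := Num.min 1%R (unit_vol R n / 2 / C)%R.
have c01 : (0 < c <= 1)%R by rewrite ge_min lexx lt_min ltr01 !divr_gt0.
have cv k : (c * (W k * S k) <= ((2 : R) ^ k) ^+ n * (unit_vol R n / 2))%R.
  have c0 : (0 <= c)%R by case/andP: c01 => /ltW.
  apply: (le_trans (ler_wpM2l c0 (WSC k))).
  have e0 : (0 < C * ((2 : R) ^ k) ^+ n)%R by rewrite mulr_gt0 ?exprn_gt0 ?exp2z_gt0.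
  apply: (@le_trans _ _ (unit_vol R n / 2 / C * (C * ((2 : R) ^ k) ^+ n))%R).
    by rewrite ler_wpM2r ?(ltW e0)// ge_min lexx orbT.
  by rewrite mulrA divfK ?gt_eqF// mulrC.
pose th := ((1 - (c / 2) `^ N * (c / 2)) `^ N^-1)%R.
have youngS x s t : (0 < s)%R -> (0 < t)%R ->
    1 <= (s * t)%:E * ((w x / s%:E) `^ p x + ((w x)^-1 / t%:E) `^ conj_exponent p x).
  move=> s0 t0; have := @young_weight R (p x) (conj_exponent p x) s t 1 (w x) (ltW (p1 x))
    (q1 x) (conj_exponentK (p1 x)) s0 t0 lee01 (w0 x).
  by rewrite mul1e.
have youngW x s t : (0 < s)%R -> (0 < t)%R ->
    1 <= (s * t)%:E * (((w x)^-1 / s%:E) `^ conj_exponent p x + (w x / t%:E) `^ p x).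
  by move=> s0 t0; rewrite addeC mulrC; exact: youngS.
have Sth k : (S (k - 1) <= th * S k)%R.
  have Smin : forall l, (0 < l)%R ->
      \int[mu]_(x in dball (k - 1)) ((w x)^-1 / l%:E) `^ conj_exponent p x <= 1 ->
      (S (k - 1) <= l)%R by case: (WS (k - 1)%R) => _ _ _ _ [].
  exact: (ball_norm_growth n0 (fun x => ltW (p1 x)) qN mp mq mw mv w0 v0 youngS (W0 k) (S0 k)
    c01 (cv k) (Wm k) (Sm k) Smin).
have Wth k : (W (k - 1) <= th * W k)%R.
  have Wmin : forall l, (0 < l)%R ->
      \int[mu]_(x in dball (k - 1)) (w x / l%:E) `^ p x <= 1 ->
      (W (k - 1) <= l)%R by case: (WS (k - 1)%R) => _ _ _ [].
  have cv' : (c * (S k * W k) <= ((2 : R) ^ k) ^+ n * (unit_vol R n / 2))%R.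
    by rewrite (mulrC (S k)).
  exact: (ball_norm_growth n0 q1 pN mq mp mv mw v0 w0 youngW (S0 k) (W0 k)
    c01 cv' (Sm k) (Wm k) Wmin).
have N1 : (1 <= N)%R by have /andP[h1 h2] := pN point; exact: le_trans h2.
have N0 := lt_le_trans ltr01 N1.
have [c0 c1] := andP c01.
have t0 : (0 < c / 2)%R by rewrite divr_gt0.
have tN0 : (0 < (c / 2) `^ N)%R by rewrite powR_gt0.
have tN1 : ((c / 2) `^ N <= 1)%R.
  by rewrite -[leRHS](powRr0 (c / 2)%R) ger_powR ?(ltW N0)// t0/=; lra.
have k0 : (0 < (c / 2) `^ N * (c / 2))%R by rewrite mulr_gt0.
have k1 : ((c / 2) `^ N * (c / 2) < 1)%R.
  have : ((c / 2) `^ N * (c / 2) <= 1 * (c / 2))%R by rewrite ler_wpM2r// ltW.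
  lra.
have th0 : (0 < th)%R by rewrite powR_gt0// subr_gt0.
have th1 : (th < 1)%R.
  have <- : (1 `^ N^-1 = 1 :> R)%R by rewrite powR1.
  by rewrite gt0_ltr_powR ?nnegrE ?invr_gt0// ?subr_ge0 ?(ltW k1)// gtrBl.
exists C, th, W, S; split => // [|j k]; first by rewrite th0.
have [jk|kj] := leP j k.
  have := geometric_growth th0 S0 Sth jk => Sj.
  apply: (@le_trans _ _ (th ^+ `|(k - j)%R|%N * (W k * S k))%R).
    by rewrite mulrCA ler_wpM2l// ltW.
  by apply: (le_trans (ler_wpM2l (exprn_ge0 _ (ltW th0)) (WSC k))); rewrite mulrCA mulrA.
have Wk := geometric_growth th0 W0 Wth (ltW kj).
apply: (@le_trans _ _ (th ^+ `|(j - k)%R|%N * (W j * S j))%R).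
  by rewrite mulrA ler_wpM2r// ltW.
rewrite -(opprB j k) abszN.
by apply: (le_trans (ler_wpM2l (exprn_ge0 _ (ltW th0)) (WSC j))); rewrite mulrCA mulrA.
Qed.

(** Hoelder's inequality on one annulus: [young_weight] is integrated at levels where both modulars
    are at most [1], hence the factor [2]. *)
Lemma integral_annulus_le p w f z (s t a M : R) : measurable_fun [set: V] p -> (1 < a)%R ->
  (forall x, a <= p x <= M)%R -> measurable_fun [set: V] w -> (forall x, 0 <= w x) ->
  measurable_fun [set: V] f -> (forall x, 0 <= f x) -> (0 < s)%R -> (0 < t)%R ->
  \int[mu]_(x in annulus z) (f x * w x / s%:E) `^ p x <= 1 ->
  \int[mu]_(x in dball z) ((w x)^-1 / t%:E) `^ conj_exponent p x <= 1 ->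
  \int[mu]_(x in annulus z) f x <= (2 * (s * t))%:E.
Proof.
move=> mp a1 pa mw w0 mf f0 s0 t0 fs wt.
have p1 x : (1 < p x)%R by have /andP[h _] := pa x; exact: lt_le_trans h.
have q1 x : (1 <= conj_exponent p x)%R by have /andP[] := conj_exponent_bounds a1 pa x.
have mq : measurable_fun [set: V] (conj_exponent p) by exact: measurable_conj_exponent.
have mv : measurable_fun [set: V] (fun x => (w x)^-1) by exact: measurable_fun_inve.
have v0 x : 0 <= (w x)^-1 by rewrite inve_ge0.
have fw0 x : 0 <= f x * w x by rewrite mule_ge0.
have mfw : measurable_fun [set: V] (fun x => f x * w x) by exact: emeasurable_funM.
have mg1 := measurable_fun_poweRM (fun x => ltW (p1 x)) s0 mp fw0 mfw.
have mg2 := measurable_fun_poweRM q1 t0 mq v0 mv.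
have mA := @measurable_annulus R n z; have mB := @measurable_dball R n z.
have AB : (annulus z : set V) `<=` dball z by apply: subDsetl.
apply: (integral_set_le_add mA _ f0 (fun x => poweR_ge0 _ _) (fun x => poweR_ge0 _ _)
  mf mg1 mg2 _ fs).
- by rewrite mulr_ge0// ltW.
- by move=> x; apply: young_weight => //; [exact: ltW|exact: conj_exponentK].
- by apply: le_trans wt; exact: (le_integral_subset _ mA mB (fun x => poweR_ge0 _ _) mg2 AB).
Qed.

(** The larger of [|x|] and [|y|] is at least [2^(max(j, k) - 1)], which bounds the denominator from
    below on [annulus (zig j)]. *)
Lemma opS_annulus_le f k x : (forall y, 0 <= f y) -> measurable_fun [set: V] f ->
  annulus (zig k) x ->
  opS f x <= \sum_(j <oo) ((2 / (2 : R) ^ Num.max (zig j) (zig k)) ^+ n)%:E *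
    \int[mu]_(y in annulus (zig j)) f y.
Proof.
move=> f0 mf /annulusP/andP[x1 x2].
pose D (y : 'rV[R]_n) := (enorm x ^+ n + enorm y ^+ n)%R.
have D0 y : (0 <= D y)%R by rewrite addr_ge0// exprn_ge0// enorm_ge0.
have mD : measurable_fun [set: V] (fun y => ((D y)%:E)^-1).
  apply: measurable_fun_inve; first by move=> y; rewrite lee_fin.
  apply/measurable_EFinP; apply: measurable_funD; first exact: measurable_cst.
  by apply: measurable_funX; exact: measurable_enorm.
have g0 y : 0 <= f y / (D y)%:E by rewrite mule_ge0// inve_ge0 lee_fin.
have mg : measurable_fun [set: V] (fun y => f y / (D y)%:E) by exact: emeasurable_funM.
rewrite /opS (integral_annuli n0 g0 mg).
apply: lee_nneseries => [j _ _|j _]; first by apply: integral_ge0.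
have e0 := @exp2z_gt0 R (Num.max (zig j) (zig k)).
apply: (integral_set_scale_le _ (measurable_annulus _) _ f0 g0 mf mg).
  by rewrite exprn_ge0// divr_ge0// ltW.
move=> y /annulusP/andP[y1 y2]; rewrite muleC lee_wpmul2r//.
have e1 : (0 < 2 ^ Num.max (zig j) (zig k) / 2 :> R)%R by rewrite divr_gt0.
have hD : ((2 ^ Num.max (zig j) (zig k) / 2) ^+ n <= D y)%R.
  have := enorm_ge0 x; have := enorm_ge0 y => ey ex.
  rewrite -exp2z_pred; have [jk|kj] := leP (zig j) (zig k).
    apply: (@le_trans _ _ (enorm x ^+ n)%R); last by rewrite lerDl exprn_ge0.
    by rewrite lerXn2r// nnegrE ltW// exp2z_gt0.
  apply: (@le_trans _ _ (enorm y ^+ n)%R); last by rewrite lerDr exprn_ge0.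
  by rewrite lerXn2r// nnegrE ltW// exp2z_gt0.
have D1 : (0 < D y)%R by apply: lt_le_trans hD; rewrite exprn_gt0.
rewrite (inve_EFin D1) lee_fin -[(2 / _)%R]invf_div exprVn lef_pV2 ?posrE//.
by rewrite exprn_gt0.
Qed.

(** [F] is not assumed measurable, so its integral is not split over the annuli. It is bounded by a
    measurable majorant, set to [+oo] at the origin, which no annulus contains. *)
Lemma integral_le_annuli (F : V -> \bar R) (G : nat -> V -> \bar R) :
  (forall x, 0 <= F x) -> (forall m x, 0 <= G m x) ->
  (forall m, measurable_fun [set: V] (G m)) ->
  (forall m x, annulus (zig m) x -> F x <= G m x) ->
  \int[mu]_x F x <= \sum_(m <oo) \int[mu]_(x in annulus (zig m)) G m x.
Proof.
move=> F0 G0 mG FG.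
have mA m := @measurable_annulus R n (zig m).
pose GA m := G m \_ (annulus (zig m)).
have GA0 m x : 0 <= GA m x by exact: erestrict_ge0.
have mGA m : measurable_fun [set: V] (GA m).
  by apply/(measurable_restrictT _ (mA m)); exact: measurable_funTS.
pose H x := \sum_(m <oo) GA m x.
have H0 x : 0 <= H x by apply: nneseries_ge0.
have mH : measurable_fun [set: V] H by apply: ge0_emeasurable_sum.
pose H' x := if enorm x == 0%R then +oo else H x.
have mH' : measurable_fun [set: V] H'.
  apply: measurable_fun_ifT; [|exact: measurable_cst|exact: mH].
  by apply: measurable_fun_eqr; [exact: measurable_enorm|exact: measurable_cst].
have -> : \sum_(m <oo) \int[mu]_(x in annulus (zig m)) G m x = \int[mu]_x H' x.
  transitivity (\int[mu]_x H x).
    rewrite /H integral_nneseries//.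
    by apply: eq_eseriesr => m _; rewrite [LHS]integral_mkcond.
  apply: ge0_ae_eq_integral => //.
    by move=> x _; rewrite /H'; case: ifP.
  exists [set x | enorm x = 0%R]; split.
  - exact: measurable_origin.
  - exact: leb_origin.
  move=> x /= h; apply: contrapT => /eqP x0; apply: h => _.
  by rewrite /H' (negbTE x0).
apply: le_integral_lower => // x; rewrite /H'; case: eqP => [_|x0]; first exact: leey.
have [|m hm] := @annulus_cover R n x.
  by rewrite lt_neqAle enorm_ge0 andbT eq_sym; apply/eqP.
apply: le_trans (FG m x hm) _.
rewrite (_ : G m x = GA m x); last by rewrite /GA patchE mem_set.
exact: (@nneseries_term R (fun m => GA m x)).
Qed.

End sufficiency.

(** * The modular of [S f] and the constants *)

Section main_estimate.
Context (R : realType) (n : nat) (n0 : (0 < n)%N).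
Local Notation V := (lebesgue_rV R n).
Local Notation mu := (leb R n).
Implicit Types (f w : V -> \bar R) (p : V -> R).

(** Since [s^(-p/q) = s^-1 s^((q - p)/q)], the level [l s^(1/q)] suited to a constant exponent [q]
    also serves [p], up to the constant [D]. *)
Lemma scaled_poweR_le (y : \bar R) (D l s q p : R) : (1 <= D)%R -> (0 < l)%R -> (0 < s)%R ->
  (1 <= p)%R -> (0 < q)%R -> 0 <= y -> (s `^ ((q - p) / q) <= D)%R ->
  (y / (D * (l * s `^ q^-1))%:E) `^ p <= (s^-1)%:E * (y / l%:E) `^ p.
Proof.
move=> D1 l0 s0 p1 q0 y0 sD; have D0 := lt_le_trans ltr01 D1.
have f0 : (0 < s `^ q^-1)%R by rewrite powR_gt0.
have yl0 : 0 <= y / l%:E by rewrite mule_ge0// inve_ge0 lee_fin ltW.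
have -> : y / (D * (l * s `^ q^-1))%:E = (D^-1)%:E * (((s `^ q^-1)^-1)%:E * (y / l%:E)).
  rewrite !inve_EFin ?mulr_gt0// [RHS]muleA -EFinM [RHS]muleCA -EFinM.
  by congr (_ * _%:E); rewrite !invfM; ring.
have fy0 : 0 <= ((s `^ q^-1)^-1)%:E * (y / l%:E) by rewrite mule_ge0// lee_fin invr_ge0 ltW.
apply: (le_trans (poweR_scale_le1 _ p1 fy0)).
  by rewrite invr_ge0 (ltW D0) invf_le1.
rewrite poweRM ?lee_fin ?invr_ge0 ?(ltW f0)// muleA -EFinM.
apply: lee_wpmul2r; first exact: poweR_ge0.
rewrite lee_fin ler_pdivrMl// -powRN -powRrM.
have -> : (- q^-1 * p = (q - p) / q - 1)%R by field; rewrite gt_eqF.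
rewrite powRB ?(gt_eqF s0) ?implybT// powRr1 ?(ltW s0)//.
by rewrite ler_wpM2r// invr_ge0 ltW.
Qed.

(** It is shown that if [l] is admissible for [f w], then [K l] is admissible for [(S f) w], with
    [K] independent of [f] and [l]. *)
Lemma strong_type_Ap0_opS p w (a M : R) : measurable_fun [set: V] p -> (1 < a)%R ->
  (forall x, a <= p x <= M)%R -> LH0 p -> LHoo p -> weight w -> A_p0 p w ->
  strong_type (@opS R n) p w.
Proof.
move=> mp a1 pa lh0 lhoo ww Aw.
have [C [th [W [S [C0 th01 WS WSC]]]]] := Ap0_kernel_bound n0 mp a1 pa ww Aw.
have [mw w0 _ _] := ww.
have [p0 [poo [L0 [p01 poo1 lhL0]]]] := log_hoelder_annuli lh0 lhoo.
pose q j := sgn_exponent p0 poo (zig j).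
pose L := Num.max 0%R L0.
have lh j x : annulus (zig j) x -> (`|p x - q j| * (`|zig j|%N)%:R <= L)%R.
  by move=> /lhL0; rewrite /L le_max => ->; rewrite orbT.
have p1 x : (1 < p x)%R by have /andP[h _] := pa x; exact: lt_le_trans h.
have q1 j : (1 <= q j)%R by rewrite /q /sgn_exponent; case: ifP.
have q0 j : (0 < q j)%R by exact: lt_le_trans (q1 j).
pose N := (Num.max M (Num.max p0 poo))%R.
have pN x : (p x <= N)%R by have /andP[_ h] := pa x; rewrite le_max h.
have qN j : (q j <= N)%R.
  by rewrite /q /sgn_exponent; case: ifP => _; rewrite !le_max lexx ?orbT.
have pqN x j : (`|p x - q j| <= N)%R.
  have := pN x; have := qN j; have := q1 j; have := p1 x => h1 h2 h3 h4.
  by rewrite ler_norml; apply/andP; split; lra.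
have [th0 th1] := andP th01.
(* A fourth root: [th = h^2] splits the decay as [nneseries_conv_powR] requires, and [h = t^2] makes
   sums over the integers at most [1 / (1 - t)]. *)
pose t := Num.sqrt (Num.sqrt th).
have st0 : (0 < Num.sqrt th)%R by rewrite sqrtr_gt0.
have t0 : (0 < t)%R by rewrite sqrtr_gt0.
have t01 : (0 < t < 1)%R.
  by rewrite t0 /t -(sqrtr1 R) ltr_sqrt// -(sqrtr1 R) ltr_sqrt.
pose h := (t ^+ 2)%R; have h01 : (0 < h < 1)%R := sqr_in01 t01.
have hth : (h ^+ 2 = th)%R by rewrite /h /t sqr_sqrtr ?sqr_sqrtr// ltW.
have [h0 h1] := andP h01.
pose Th := ((1 - t)^-1)%R; have Th1 : (1 <= Th)%R := inv1B_ge1 t01.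
have Th0 := lt_le_trans ltr01 Th1.
have Th2 : (2 <= 2 * Th)%R by lra.
(* The bound of [powR_comparable] for quantities between [h^|k|] and [2 Th]; both [al] and [Mr]
   below lie in this range. *)
pose D := (h `^ (- L) * (2 * Th) `^ N)%R.
have L_ge0 : (0 <= L)%R by rewrite le_max lexx.
have S1 : (1 <= 2 * Th)%R by lra.
have comparable j x s e : annulus (zig j) x -> (h ^+ `|zig j|%N <= s <= 2 * Th)%R ->
    (`|e| <= `|p x - q j| / q j)%R -> (s `^ e <= D)%R.
  move=> jx sS ee; have e1 : (`|e| <= `|p x - q j|)%R.
    by apply: (le_trans ee); rewrite ler_pdivrMr// ler_peMr.
  apply: (powR_comparable h01 S1 sS); last exact: le_trans (pqN x j).
  by apply: le_trans (lh _ _ jx); rewrite ler_wpM2r.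
have D1 : (1 <= D)%R.
  have N_ge0 : (0 <= N)%R by apply: le_trans (pN point); exact: le_trans ler01 (ltW (p1 _)).
  have := @powR_comparable R h (2 * Th) L N 1 0 0 h01 S1.
  by rewrite normr0 mul0r expr0 powRr0; apply; rewrite ?lexx.
clearbody D; have D0 := lt_le_trans ltr01 D1.
(* The factors come from [opS_annulus_le], [integral_annulus_le], the kernel bound, the levels [s j]
   and [nneseries_conv_powR], in this order. *)
pose C1 := (2 ^+ n * 2 * C * D * (2 * Th))%R.
have C10 : (0 < C1)%R.
  apply: mulr_gt0; last by lra.
  by apply: mulr_gt0 => //; apply: mulr_gt0 => //; apply: mulr_gt0.
(* [1 + Th] bounds the sum of [al], one more [Th] is the cost of the convolution, and [D] that of
   returning from [q k] to [p]; with [K = C1 E] the final modular is bounded by exactly [1]. *)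
pose E := (D * (Th * (1 + Th)))%R.
have E1 : (1 <= E)%R.
  have TT : (1 <= Th * (1 + Th))%R by rewrite mulr_ege1//; lra.
  by rewrite /E mulr_ege1.
have E0 := lt_le_trans ltr01 E1.
pose K := (C1 * E)%R; have K0 : (0 < K)%R by rewrite mulr_gt0.
exists K; split => // f f0 [mf _].
rewrite -lee_pdivrMl//; apply: le_vnorm => l l0 hl.
rewrite lee_pdivrMl// -EFinM; apply: vnorm_le; first exact: mulr_gt0.
have fw0 x : 0 <= f x * w x by rewrite mule_ge0.
have mfw : measurable_fun [set: V] (fun x => f x * w x) by exact: emeasurable_funM.
have p1' x : (1 <= p x)%R by exact: ltW.
pose g x := (f x * w x / l%:E) `^ p x.
have g0 x : 0 <= g x by exact: poweR_ge0.
have mg : measurable_fun [set: V] g by exact: (measurable_fun_poweRM p1' l0 mp fw0 mfw).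
have g1 : \int[mu]_x g x <= 1.
  by apply: le_trans hl; under [leRHS]eq_integral do rewrite gee0_abs//.
have mA j := @measurable_annulus R n (zig j).
pose m j := \int[mu]_(x in annulus (zig j)) g x.
have m0 j : 0 <= m j by exact: integral_ge0.
have msum : \sum_(j <oo) m j <= 1 by rewrite -(integral_annuli n0 g0 mg).
have m1 j : m j <= 1 by apply: le_trans msum; exact: nneseries_term.
have mE j : m j = (fine (m j))%:E.
  by rewrite fineK// ge0_fin_numE// (le_lt_trans (m1 j))// ltry.
have hz_ge0 j : (0 <= h ^+ `|zig j|%N)%R by rewrite exprn_ge0// ltW.
pose al j := (fine (m j) + h ^+ `|zig j|%N)%R.
have alb j : (h ^+ `|zig j|%N <= al j <= 2)%R.
  have h2 : (h ^+ `|zig j|%N <= 1)%R by rewrite exprn_ile1// ltW.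
  have h3 : (0 <= fine (m j))%R by rewrite fine_ge0.
  have h4 : (fine (m j) <= 1)%R by rewrite -lee_fin -mE.
  by rewrite /al lerDr h3 (le_trans (lerD h4 h2)).
have al0 j : (0 < al j)%R.
  by have /andP[+ _] := alb j; apply: lt_le_trans; rewrite exprn_gt0.
have al_sum : \sum_(j <oo) (al j)%:E <= (1 + Th)%:E.
  have -> : \sum_(j <oo) (al j)%:E =
      \sum_(j <oo) m j + \sum_(j <oo) (h ^+ `|zig j|%N)%:E.
    rewrite -nneseriesD => [|j _ _|j _ _]; rewrite ?lee_fin//.
    by apply: eq_eseriesr => j _; rewrite [in RHS]mE -EFinD.
  rewrite EFinD leeD//.
  have := @nneseries_absz_zig R t 0%R; rewrite (ltW t0)/=.
  under eq_eseriesr do rewrite subr0.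
  by apply; case/andP: t01.
have al2 i : (0 <= al i <= 2)%R by rewrite ltW//=; case/andP: (alb i).
have convb k : conv t al k <= (2 * Th)%:E by exact: (conv_le t01 _ al2).
have conv0 k : 0 <= conv t al k.
  by apply: nneseries_ge0 => j _ _; rewrite lee_fin mulr_ge0 ?exprn_ge0 ?ltW.
pose Mr k := fine (conv t al k).
have MrE k : conv t al k = (Mr k)%:E.
  by rewrite fineK// ge0_fin_numE// (le_lt_trans (convb k))// ltry.
(* The diagonal term of the convolution hands the lower bound from [al] on to [Mr]. *)
have Mrb k : (h ^+ `|zig k|%N <= Mr k <= 2 * Th)%R.
  rewrite -[X in _ && X]lee_fin -MrE convb andbT.
  apply: (@le_trans _ _ (al k)); first by case/andP: (alb k).
  rewrite -lee_fin -MrE.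
  have := @nneseries_term R (fun j => (h ^+ zdist k j * al j)%:E) k.
  have zd0 : zdist k k = 0%N by rewrite /zdist subrr.
  rewrite /= zd0 expr0 mul1r; apply => j.
  by rewrite lee_fin mulr_ge0 ?exprn_ge0 ?ltW.
have Mr0 k : (0 < Mr k)%R.
  by have /andP[+ _] := Mrb k; apply: lt_le_trans; rewrite exprn_gt0.
have Mr_sum : \sum_(k <oo) (Mr k)%:E <= (Th * (1 + Th))%:E.
  under eq_eseriesr do rewrite -MrE.
  apply: (le_trans (nneseries_conv_le t01 (fun j => ltW (al0 j)))).
  by rewrite EFinM lee_wpmul2l// lee_fin ltW.
(* For [p] constant equal to [q j], the level [l (al j)^(1 / q j)] would be admissible for [f w] on
   the annulus; [D] absorbs the deviation of [p] from [q j]. *)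
pose s j := (D * (l * al j `^ (q j)^-1))%R.
have s0 j : (0 < s j)%R by rewrite /s !mulr_gt0// powR_gt0.
have fs j : \int[mu]_(x in annulus (zig j)) (f x * w x / (s j)%:E) `^ p x <= 1.
  apply: (@le_trans _ _ ((al j)^-1%:E * m j)); last first.
    rewrite mE -EFinM lee_fin ler_pdivrMl// mulr1 /al lerDl//.
  have mfs := measurable_fun_poweRM p1' (s0 j) mp fw0 mfw.
  apply: (integral_set_scale_le _ (mA j) _ g0 (fun x => poweR_ge0 _ _) mg mfs).
    by rewrite invr_ge0 ltW.
  move=> x jx; apply: scaled_poweR_le => //.
  apply: (comparable j x) => //.
    by have /andP[-> h2] := alb j; exact: le_trans Th2.
  by rewrite normrM (gtr0_norm (_ : 0 < (q j)^-1)%R) ?invr_gt0// distrC.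
have W0 k : (0 < W k)%R by case: (WS k).
have S0 k : (0 < S k)%R by case: (WS k).
have fint j : \int[mu]_(x in annulus (zig j)) f x <= (2 * (s j * S (zig j)))%:E.
  have [_ _ _ Sm] := WS (zig j).
  exact: (integral_annulus_le mp a1 pa mw w0 mf f0 (s0 j) (S0 _) (fs j) Sm).
have opSb k x : annulus (zig k) x ->
    opS f x <= (C1 * l * Mr k `^ (q k)^-1 / W (zig k))%:E.
  move=> kx; apply: (le_trans (opS_annulus_le n0 f0 mf kx)).
  have Wk0 := W0 (zig k).
  pose c := (2 ^+ n * 2 * C * D * l / W (zig k))%R.
  have c0 : (0 <= c)%R by rewrite divr_ge0 ?(ltW Wk0)// !mulr_ge0 ?exprn_ge0 ?ltW.
  have phi0 j : (0 <= al j `^ (q j)^-1)%R by exact: powR_ge0.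
  apply: (@le_trans _ _ (\sum_(j <oo)
      (c%:E * ((h ^+ 2) ^+ zdist k j * al j `^ (q j)^-1)%:E))).
    apply: lee_nneseries => [j _ _|j _].
      rewrite mule_ge0 ?lee_fin ?exprn_ge0 ?divr_ge0 ?(ltW (exp2z_gt0 _ _))//.
      exact: integral_ge0.
    have e0 := @exp2z_gt0 R (Num.max (zig j) (zig k)).
    set e := (2 ^ _)%R in e0 *; have en0 : (0 < e ^+ n)%R by rewrite exprn_gt0.
    apply: (@le_trans _ _ (((2 / e) ^+ n)%:E * (2 * (s j * S (zig j)))%:E)).
      by rewrite lee_wpmul2l// lee_fin exprn_ge0// divr_ge0// ltW.
    rewrite -!EFinM lee_fin hth expr_div_n.
    have := WSC (zig j) (zig k); rewrite -/(zdist k j) -/e => WSjk.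
    have -> : (2 ^+ n / e ^+ n * (2 * (s j * S (zig j))) =
        (2 ^+ n * 2 * D * l * al j `^ (q j)^-1 / (W (zig k) * e ^+ n)) *
        (W (zig k) * S (zig j)))%R.
      by rewrite /s; field; rewrite !gt_eqF.
    have -> : (c * (th ^+ zdist k j * al j `^ (q j)^-1) =
        (2 ^+ n * 2 * D * l * al j `^ (q j)^-1 / (W (zig k) * e ^+ n)) *
        (C * th ^+ zdist k j * e ^+ n))%R.
      by rewrite /c; field; rewrite !gt_eqF.
    apply: ler_wpM2l => //.
    by rewrite divr_ge0 ?mulr_ge0 ?exprn_ge0 ?powR_ge0 ?(ltW D0) ?(ltW l0) ?(ltW Wk0) ?(ltW e0).
  rewrite nneseriesZl; last by move=> j _; rewrite lee_fin mulr_ge0// !exprn_ge0// ltW.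
  apply: (@le_trans _ _ (c%:E * (2 * Th * Mr k `^ (q k)^-1)%:E)).
    rewrite lee_wpmul2l ?lee_fin//.
    exact: (nneseries_conv_powR t01 p01 poo1 alb (MrE k)).
  rewrite -EFinM lee_fin le_eqVlt; apply/orP; left; apply/eqP.
  by rewrite /c /C1; field; rewrite gt_eqF.
(* Majorant of the integrand on the annulus of index [k]. The modular of [w / W_k] is at most [1],
   so it integrates to at most [C1 / K * D * Mr k]. *)
pose G k x := (C1 / K * D * Mr k)%:E * (w x / (W (zig k))%:E) `^ p x.
have CK0 : (0 < C1 / K)%R by rewrite divr_gt0.
have c0 k : (0 <= C1 / K * D * Mr k)%R.
  by rewrite ltW// mulr_gt0// mulr_gt0.
have mwW k : measurable_fun [set: V] (fun x => (w x / (W (zig k))%:E) `^ p x).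
  exact: (measurable_fun_poweRM p1' (W0 _) mp w0 mw).
have G0 k x : 0 <= G k x by rewrite mule_ge0 ?poweR_ge0// lee_fin.
have mG k : measurable_fun [set: V] (G k) by exact: measurable_funeM.
have FG k x : annulus (zig k) x ->
    (`|opS f x * w x| / (K * l)%:E) `^ p x <= G k x.
  move=> kx; have Kl0 : (0 < K * l)%R by rewrite mulr_gt0.
  have Sx0 : 0 <= opS f x by exact: opS_ge0.
  have Wk0 := W0 (zig k).
  rewrite gee0_abs ?mule_ge0//.
  have wW0 : 0 <= w x / (W (zig k))%:E by rewrite mule_ge0// inve_ge0 lee_fin ltW.
  have y0 : 0 <= (Mr k `^ (q k)^-1)%:E * (w x / (W (zig k))%:E).
    by rewrite mule_ge0// lee_fin powR_ge0.
  apply: (@le_trans _ _ (((C1 / K)%:E *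
      ((Mr k `^ (q k)^-1)%:E * (w x / (W (zig k))%:E))) `^ p x)).
    apply: le_poweR; first exact: le_trans (p1' x).
      by rewrite mule_ge0 ?mule_ge0// inve_ge0 lee_fin ltW.
    apply: (@le_trans _ _ ((C1 * l * Mr k `^ (q k)^-1 / W (zig k))%:E * w x / (K * l)%:E)).
      by rewrite !lee_wpmul2r// ?inve_ge0 ?lee_fin ?(ltW Kl0)// opSb.
    rewrite !inve_EFin// [leRHS]muleA -EFinM (muleC (w x)) [leRHS]muleA -EFinM.
    rewrite muleAC -EFinM (_ : (_ / _ * _ = C1 / K * Mr k `^ (q k)^-1 / W (zig k))%R)//.
    by field; rewrite !gt_eqF.
  apply: (le_trans (poweR_scale_le1 _ (p1' x) y0)).
    rewrite (ltW CK0)/= ler_pdivrMr// mul1r /K.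
    by rewrite ler_peMr// ltW.
  rewrite /G poweRM ?lee_fin ?powR_ge0// muleA -EFinM.
  apply: lee_wpmul2r; first exact: poweR_ge0.
  rewrite lee_fin -mulrA (ler_wpM2l (ltW CK0))//.
  (* The power [p / q k] is split as [1 + (p - q k) / q k]: the first part is summable in [k], the
     second is at most [D]. *)
  rewrite -powRrM (_ : ((q k)^-1 * p x = (p x - q k) / q k + 1)%R); last first.
    by field; rewrite gt_eqF.
  rewrite powRD ?(gt_eqF (Mr0 k)) ?implybT// powRr1 ?(ltW (Mr0 k))//.
  rewrite ler_wpM2r ?(ltW (Mr0 k))//.
  apply: (comparable k x) => //.
  by rewrite normrM (gtr0_norm (_ : 0 < (q k)^-1)%R) ?invr_gt0.
have := @integral_le_annuli R n n0 (fun x => (`|opS f x * w x| / (K * l)%:E) `^ p x) G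
  (fun x => poweR_ge0 _ _) G0 mG FG.
rewrite -[X in X <= _]/(modular p (fun x => opS f x * w x) (K * l)) => /le_trans; apply.
apply: (@le_trans _ _ (\sum_(k <oo) ((C1 / K * D)%:E * (Mr k)%:E))).
  apply: lee_nneseries => [k _ _|k _]; first by apply: integral_ge0.
  apply: (le_trans (integral_set_scale_le _ (mA k) (c0 k) (fun x => poweR_ge0 _ _)
     (G0 k) (mwW k) (mG k) (fun x _ => lexx _))).
  rewrite -EFinM -[leRHS]mule1 lee_wpmul2l ?lee_fin//.
  have [_ _ Wm _] := WS (zig k); apply: le_trans Wm.
  apply: (le_integral_subset _ (mA k) (measurable_dball _) (fun x => poweR_ge0 _ _) (mwW k)).
  exact: subDsetl.
have CKD0 : (0 <= C1 / K * D)%R by rewrite ltW// mulr_gt0.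
rewrite nneseriesZl; last by move=> k _; rewrite lee_fin ltW.
apply: (@le_trans _ _ ((C1 / K * D)%:E * (Th * (1 + Th))%:E)).
  by rewrite lee_wpmul2l ?lee_fin.
rewrite -EFinM lee_fin le_eqVlt; apply/orP; left; apply/eqP.
by rewrite /K /E; field; rewrite !gt_eqF//; lra.
Qed.

End main_estimate.

Theorem theorem1p12 (R : realType) (n : nat) (hn : (0 < n)%N)
    (p : lebesgue_rV R n -> R) (hp : exponent p)
    (hLH0 : LH0 p) (hLHoo : LHoo p)
    (hpm : 1 < exp_inf p) (hpmp : exp_inf p <= exp_sup p)
    (hpp : exp_sup p < +oo)
    (w : lebesgue_rV R n -> \bar R) (hw : weight w) :
  (strong_type (@opN R n) p w <-> strong_type (@opS R n) p w) /\
  (strong_type (@opS R n) p w <-> A_p0 p w).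
Proof.
have [a [M [a1 pa]]] := exponent_bounds hp hpm.
have [mp p1 _] := hp; have [_ w0 _ _] := hw.
have p0 x : (0 <= p x)%R by exact: le_trans (p1 x).
have SN := strong_type_opS_opN p0 w0.
have NA := strong_type_opN_Ap0 mp a1 pa hw.
have AS := strong_type_Ap0_opS hn mp a1 pa hLH0 hLHoo hw.
by split; [split=> [/NA/AS|/SN]|split=> [/SN/NA|/AS]].
Qed.
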